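(* Let $d \ge 2$ be an integer, $\mu \in \mathbb{S}^{d-1}$ and $\kappa \ge 0$. Let $X$ be a random vector on $\mathbb{S}^{d-1}=\{x\in\mathbb{R}^d : \|x\|_2=1\}$ with density (with respect to the surface measure on $\mathbb{S}^{d-1}$) proportional to $(1+\mu^\top x)^\kappa$, and let $T = \mu^\top X$. Then $T \overset{d}{=} 2Z - 1$ where $Z \sim \operatorname{Beta}(\alpha,\beta)$ with $\alpha = \frac{d-1}{2}+\kappa$ and $\beta = \frac{d-1}{2}$.
   Context: $\operatorname{Beta}(\alpha,\beta)$ denotes the distribution on $[0,1]$ with density $B(\alpha,\beta)^{-1} z^{\alpha-1}(1-z)^{\beta-1}$, where $B(a,b)=\Gamma(a)\Gamma(b)/\Gamma(a+b)$. The normalized distribution with density proportional to $(1+\mu^\top x)^\kappa$ on $\mathbb{S}^{d-1}$ is called the Power Spherical distribution with direction $\mu$ and concentration $\kappa$. *)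

(* Defs.v *)
From HB Require Import structures.
From mathcomp Require Import all_boot all_order all_algebra.
From mathcomp Require Import all_classical all_reals all_analysis.
Set Implicit Arguments. Unset Strict Implicit. Unset Printing Implicit Defensive.
Import Order.TTheory GRing.Theory Num.Theory.
Import numFieldNormedType.Exports.
Local Open Scope classical_set_scope.
Local Open Scope ring_scope.

Section PS.
Variables (R : realType) (d : nat).

(* R^d is represented by d.-tuple R, with the product (Borel) sigma-algebra
   provided by MathComp-Analysis. *)
Definition dotv (x y : d.-tuple R) : R := \sum_(i < d) tnth x i * tnth y i.

Definition scalev (r : R) (x : d.-tuple R) : d.-tuple R :=
  [tuple r * tnth x i | i < d].

Definition sphere : set (d.-tuple R) := [set x | dotv x x = 1].

Definition box (a b : d.-tuple R) : set (d.-tuple R) :=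
  [set x | forall i, tnth a i <= tnth x i <= tnth b i].

(* lam is Lebesgue measure on R^d: it gives every box its volume.  (This
   characterizes Lebesgue measure on the product sigma-algebra.) *)
Definition is_lebesgue (lam : {measure set (d.-tuple R) -> \bar R}) : Prop :=
  forall a b : d.-tuple R, (forall i, tnth a i <= tnth b i) ->
    lam (box a b) = (\prod_(i < d) (tnth b i - tnth a i))%:E.

Definition cone (A : set (d.-tuple R)) : set (d.-tuple R) :=
  [set y | exists (r : R) (x : d.-tuple R),
    [/\ 0 < r <= 1, (A `&` sphere) x & y = scalev r x]].

(* surface measure on the sphere (cone construction):
   sigma(A) = d * lam(cone A); it equals the (d-1)-dim. Hausdorff measure. *)
Definition surface (lam : {measure set (d.-tuple R) -> \bar R})
  (A : set (d.-tuple R)) : \bar R := (d%:R)%:E * lam (cone A).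

Definition ps_dens (mu : d.-tuple R) (kappa : R) (x : d.-tuple R) : R :=
  (1 + dotv mu x) `^ kappa.

End PS.

Section BetaDef.
Variable R : realType.

Definition Gammaf (a : R) : R :=
  \int[@lebesgue_measure R]_(t in `]0%R, +oo[) (t `^ (a - 1) * expR (- t)).

Definition Betaf (a b : R) : R := Gammaf a * Gammaf b / Gammaf (a + b).

Definition beta_dens (a b : R) (z : R) : R :=
  z `^ (a - 1) * (1 - z) `^ (b - 1) / Betaf a b.

End BetaDef.

(* Main.v *)
(* With N(y) = y / |y|, the surface integral of a function of mu.x equals, up to
   the factor d, the integral of the same function of mu.N(y) over the punctured
   unit ball, a function of u = mu.y and w = |y|^2 - u^2 alone. By induction on
   d >= 2, the law of (u, w) under Lebesgue measure is c du w^(b-1) dw with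
   b = (d-1)/2: write mu = (a, sqrt(1-a^2) nu), split off the first coordinate
   by Fubini, use the induction hypothesis for nu, rotate a plane, and add the
   square of the leftover coordinate to w, which is a Beta convolution. The
   substitutions u^2 = s p, w = s (1 - p), p = t^2 and t = 2 z - 1 then turn the
   integral into that of z^(b+kappa-1) (1-z)^(b-1). The normalising constant is
   forced by P having total mass 1, and equals Gamma(a) Gamma(b) / Gamma(a+b)
   by the same substitution applied to exp(-x-y). *)
Require Import Defs.
From HB Require Import structures.
From mathcomp Require Import all_boot all_order all_algebra.
From mathcomp Require Import all_classical all_reals all_analysis.
From mathcomp Require Import measurable_realfun ring.
Import Order.TTheory GRing.Theory Num.Theory.
Import numFieldNormedType.Exports.
Local Open Scope classical_set_scope.
Local Open Scope ring_scope.
Set Implicit Arguments. Unset Strict Implicit. Unset Printing Implicit Defensive.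

(** * Linear changes of variables *)

(** No multivariate Jacobian formula is used. Each substitution is broken under Tonelli into
    one-variable ones, affine maps and squaring, and these follow from uniqueness of Lebesgue
    measure on the line. All integrands are nonnegative, extended-real and defined on whole lines,
    with weights extended by 0, so neither integrability nor domains have to be tracked. The price
    is that constants may be infinite; they are carried along unevaluated until the last step.
    Finiteness of the total mass then also yields convergence of the Beta integral, whose weight is
    singular when d = 2 (beta = 1/2), so that only Gamma(alpha + beta), at an argument at least 1,
    is bounded by hand. A separate obstacle is that [surface] is a bare set function, so an integral
    against it must first be identified with one against a measure. *)

Lemma pushforward_measure_ex (R : realType) (d d' : measure_display)
    (T : measurableType d) (T' : measurableType d') (m : {measure set T -> \bar R})
    (phi : T -> T') : measurable_fun setT phi ->
  exists nu : {measure set T' -> \bar R}, nu = pushforward m phi :> (set T' -> \bar R).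
Proof.
move=> mphi.
by exists (measure_function_pushforward__canonical__measure_function_Measure m mphi).
Qed.

(** Reduces a substitution to an equality of measures, to be checked by uniqueness. The source
    measure [m'] may carry a scale factor or a density, which is how Jacobians enter. *)
Lemma ge0_integral_comp_measure_preserving (R : realType)
    (d : measure_display) (T : measurableType d) (m : {measure set T -> \bar R})
    (d' : measure_display) (T' : measurableType d')
    (m' : {measure set T' -> \bar R}) (phi : T' -> T) (f : T -> \bar R) :
  measurable_fun setT phi -> measurable_fun setT f -> (forall x, (0 <= f x)%E) ->
  (forall A, measurable A -> m A = m' (phi @^-1` A)) ->
  (\int[m]_x f x = \int[m']_x f (phi x))%E.
Proof.
move=> mphi mf f0 mm'.
transitivity (\int[m']_(x in phi @^-1` setT) (f \o phi) x)%E => //.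
rewrite -(ge0_integral_pushforward mphi) //.
have [nu nuE] := pushforward_measure_ex m' mphi.
by rewrite -nuE; apply: eq_measure_integral => A mA _; rewrite nuE mm'.
Qed.

Section affine.
Variable R : realType.
Local Notation mu := (@lebesgue_measure R).

Lemma measurable_affine (k m : R) : measurable_fun setT (fun x : R => k * x + m).
Proof.
by apply: measurable_funD => //; apply: measurable_funM.
Qed.

Lemma lebesgue_measure_affine (k m : R) (A : set R) : 0 < k -> measurable A ->
  mu A = (k%:E * mu ((fun x : R => k * x + m)%R @^-1` A))%E.
Proof.
move=> k0 mA.
have mf : measurable_fun setT ((fun x : R => k * x + m) : measurableTypeR R -> measurableTypeR R).
  exact: measurable_affine.
have [nu nuE] := pushforward_measure_ex mu mf.
have -> : (k%:E * mu ((fun x : R => k * x + m)%R @^-1` A))%E =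
    mscale (NngNum (ltW k0)) nu A by rewrite /mscale nuE.
apply: lebesgue_measure_unique => // X [[a b] _ <-] /=.
rewrite /mscale /= nuE /pushforward.
transitivity (k%:E * (if (a < b)%R then ((b - a) / k)%:E else 0))%E; last first.
  congr (_ * _)%E; transitivity (mu [set` `](a - m) / k, (b - m) / k]]).
    rewrite lebesgue_measure_itv /= !lte_fin ltr_pM2r ?invr_gt0// ltrD2r.
    by case: ifP => // _; rewrite -EFinD -mulrBl opprB addrA subrK.
  congr (mu _); apply/seteqP; split => x /=;
    by rewrite !in_itv /= ltr_pdivrMr// ler_pdivlMr// ltrBlDr lerBrDr mulrC.
rewrite lebesgue_measure_itv /= lte_fin; case: ifP => _; last by rewrite mule0.
by rewrite -EFinM mulrCA divff ?mulr1 ?gt_eqF.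
Qed.

Lemma ge0_integral_affine (k m : R) (f : R -> \bar R) : 0 < k ->
  measurable_fun setT f -> (forall x, (0 <= f x)%E) ->
  (\int[mu]_x f x = k%:E * \int[mu]_x f (k * x + m)%R)%E.
Proof.
move=> k0 mf f0.
have -> : (\int[mu]_x f x = \int[mscale (NngNum (ltW k0)) mu]_x f (k * x + m)%R)%E.
  apply: ge0_integral_comp_measure_preserving => //; first exact: measurable_affine.
  by move=> A mA; exact: lebesgue_measure_affine.
rewrite ge0_integral_mscale //.
by apply: measurableT_comp => //; exact: measurable_affine.
Qed.

Lemma ge0_integral_opp (f : R -> \bar R) :
  measurable_fun setT f -> (forall x, (0 <= f x)%E) ->
  (\int[mu]_x f x = \int[mu]_x f (- x)%R)%E.
Proof.
move=> mf f0; apply: ge0_integral_comp_measure_preserving => //.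
by move=> A mA; apply/esym; exact: lebesgue_measureN.
Qed.

Lemma ge0_integral_affineN0 (k m : R) (f : R -> \bar R) : k != 0 ->
  measurable_fun setT f -> (forall x, (0 <= f x)%E) ->
  (\int[mu]_x f x = `|k|%:E * \int[mu]_x f (k * x + m)%R)%E.
Proof.
move=> k0 mf f0; case: (ltgtP k 0) k0 => [kn|kp|//].
- move=> _; rewrite (@ge0_integral_affine (- k) m) ?oppr_gt0// ltr0_norm//.
  congr (_ * _)%E; rewrite ge0_integral_opp //.
    by apply: eq_integral => x _; rewrite mulrNN.
  by apply: measurableT_comp => //; exact: measurable_affine.
- by move=> _; rewrite gtr0_norm// -ge0_integral_affine.
Qed.

End affine.

(** * Power weights on the positive half-line *)

Section pospow.
Variable R : realType.
Local Notation mu := (@lebesgue_measure R).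

(* The weight x^(a-1) on the positive half-line, extended by 0 so that every
   integral ranges over the whole line; powR itself is 1 on negative reals. *)
Definition pospow (a x : R) : R := if 0 < x then x `^ (a - 1) else 0.

Lemma pospow_ge0 a x : 0 <= pospow a x.
Proof. by rewrite /pospow; case: ifP => // _; exact: powR_ge0. Qed.

Lemma pospow_eq0 a x : x <= 0 -> pospow a x = 0.
Proof. by move=> x0; rewrite /pospow ltNge x0. Qed.

Lemma pospow_gt0 a x : 0 < x -> 0 < pospow a x.
Proof. by move=> x0; rewrite /pospow x0 powR_gt0. Qed.

Lemma measurable_pospow a : measurable_fun setT (pospow a).
Proof. by apply: measurable_fun_ifT => //; exact: measurable_fun_ltr. Qed.

Lemma pospow1E x : pospow 1 x = (0 < x)%R%:R.
Proof. by rewrite /pospow subrr powRr0; case: ifP. Qed.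

Lemma pospowM a s x : 0 < s -> pospow a (s * x) = s `^ (a - 1) * pospow a x.
Proof.
move=> s0; rewrite /pospow pmulr_rgt0//; case: ifPn => x0; last by rewrite mulr0.
by rewrite powRM // ltW.
Qed.

Lemma integral_itv_double (x y : R) : 0 <= x -> x < y ->
  (\int[mu]_(v in `]x, y]) (2 * v)%:E = (y ^+ 2 - x ^+ 2)%:E)%E.
Proof.
move=> x0 xy.
rewrite integral_itv_obnd_cbnd; last first.
  by apply/measurable_EFinP; apply: measurable_funTS; exact: measurable_funM.
rewrite EFinB.
apply: (@continuous_FTC2 _ (fun v : R => 2 * v) (fun v : R => v ^+ 2)) => //.
- apply: continuous_subspaceT => v; apply: cvgMr; exact: cvg_id.
- split.
  + by move=> z _; exact: ex_derive.
  + apply/cvg_at_right_filter; exact: exprn_continuous.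
  + apply/cvg_at_left_filter; exact: exprn_continuous.
- move=> z _; rewrite derive1E.
  by rewrite exp_derive /= expr1 /GRing.scale /= mulr1 mulr_natl.
Qed.

End pospow.

(** * Measures given by a density *)

Section density.
Context (d : measure_display) (T : measurableType d) (R : realType).
Variables (m : {measure set T -> \bar R}) (w : T -> R).
Hypotheses (mw : measurable_fun setT w) (w0 : forall x, 0 <= w x).
Local Open Scope ereal_scope.

Let dens (A : set T) := \int[m]_(x in A) (w x)%:E.

Let dens0 : dens set0 = 0. Proof. by rewrite /dens integral_set0. Qed.

Let dens_ge0 A : 0 <= dens A.
Proof. by apply: integral_ge0 => x _; rewrite lee_fin. Qed.

Let dens_sigma_additive : semi_sigma_additive dens.
Proof.
apply: semi_sigma_additive_nng_induced; first exact/measurable_EFinP.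
by move=> x; rewrite lee_fin.
Qed.

HB.instance Definition _ := isMeasure.Build _ _ _ dens dens0 dens_ge0 dens_sigma_additive.

Import HBNNSimple.

(** Makes a density a genuine measure, possibly of infinite mass, so that pushforward and uniqueness
    apply to it. The integral formula passes from simple functions to [g] by monotone
    convergence. *)
Lemma density_measure : exists nu : {measure set T -> \bar R},
  (forall A, nu A = \int[m]_(x in A) (w x)%:E) /\
  (forall g : T -> \bar R, measurable_fun setT g -> (forall x, 0 <= g x) ->
    \int[nu]_x g x = \int[m]_x ((w x)%:E * g x)).
Proof.
exists dens; split=> // g mg g0.
pose g_ := nnsfun_approx measurableT mg.
transitivity (limn (fun n => \int[dens]_x (g_ n x)%:E)).
  rewrite -monotone_convergence//=.
  - apply: eq_integral => x _; apply/esym/cvg_lim => //=.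
    exact: cvg_nnsfun_approx.
  - by move=> n; exact/measurable_EFinP.
  - by move=> n x _; rewrite lee_fin.
  - by move=> x _ a b ab; rewrite lee_fin; exact/lefP/nd_nnsfun_approx.
transitivity (limn (fun n => \int[m]_x ((w x)%:E * (g_ n x)%:E))); last first.
  rewrite -monotone_convergence//=.
  - apply: eq_integral => x _; apply/cvg_lim => //=.
    apply: cvgeZl => //; exact: cvg_nnsfun_approx.
  - by move=> n; apply/measurable_EFinP/measurable_funM.
  - by move=> n x _; rewrite lee_fin mulr_ge0.
  - move=> x _ a b ab; rewrite lee_fin ler_wpM2l//.
    exact/lefP/nd_nnsfun_approx.
apply: congr_lim; apply/funext => n.
under [in LHS]eq_integral do rewrite fimfunE -fsumEFin//. 
rewrite ge0_integral_fsum//; last 2 first.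
- by move=> y; exact/measurable_EFinP/measurable_funM.
- by move=> y x _; rewrite nnfun_muleindic_ge0.
transitivity (\sum_(k \in range (g_ n))
    \int[m]_x ((w x)%:E * (k * \1_(g_ n @^-1` [set k]) x)%:E)).
  apply: eq_fsbigr => r _.
  rewrite integralZl_indic_nnsfun// integral_indic// setIT /= /dens integral_mkcond.
  (* The approximant is nonnegative, so a negative level has empty preimage and both terms
     vanish. *)
  have [r0|r0] := ltP r 0%R.
    rewrite preimage_nnfun0// patch_set0 integral0 mule0 integral0_eq// => x _.
    by rewrite indic0 mulr0 mule0.
  rewrite -ge0_integralZl//.
  - apply: eq_integral => x _; rewrite patchE indicE.
    by case: ifP => _; rewrite ?mulr1 ?mulr0 ?mule0// muleC.
  - exact/(measurable_restrictT _ _).1/measurable_funTS/measurable_EFinP.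
  - by move=> x _; rewrite erestrict_ge0// => y _; rewrite lee_fin.
rewrite -ge0_integral_fsum//.
- apply: eq_integral => x _; rewrite [in RHS]fimfunE -fsumEFin// ge0_mule_fsumr//.
  by move=> k; exact: nnfun_muleindic_ge0.
- by move=> r; apply/measurable_EFinP/measurable_funM => //; exact: measurable_funM.
- by move=> r x _; apply: mule_ge0; [rewrite lee_fin|exact: nnfun_muleindic_ge0].
Qed.

End density.

(** * Quadratic change of variables *)

Section square.
Variable R : realType.
Local Notation mu := (@lebesgue_measure R).

Lemma pospow2E (v : R) : 0 < v -> pospow 2 v = v.
Proof.
by move=> v0; rewrite /pospow v0 (_ : 2 - 1 = 1) ?powRr1 ?ltW//; ring.
Qed.

Lemma measurable_le0 : measurable_fun setT (fun q : R => ((q <= 0)%R%:R : R)).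
Proof.
rewrite (_ : (fun q => _) = fun q => if (q <= 0)%R then 1 else 0); last first.
  by apply/funext => q; case: ifP.
by apply: measurable_fun_ifT => //; exact: measurable_fun_ler.
Qed.

(** The preimage has a negative branch too, but the weight vanishes there; on the positive branch
    the density 2v integrates to v^2. *)
Lemma integral_sqr_preimage_itv (a b : R) : 0 <= a -> a < b ->
  (\int[mu]_(v in (fun v : R => v ^+ 2)%R @^-1` `]a, b]) (2 * pospow 2 v)%:E = (b - a)%:E)%E.
Proof.
move=> a0 ab; have b0 : 0 < b by exact: le_lt_trans ab.
have sab : Num.sqrt a < Num.sqrt b by rewrite ltr_sqrt.
have := integral_itv_double (sqrtr_ge0 a) sab.
rewrite !sqr_sqrtr ?(ltW b0)// => <-.
rewrite integral_mkcond [RHS]integral_mkcond; apply: eq_integral => v _.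
rewrite !patchE.
have [v0|v0] := leP v 0.
  rewrite pospow_eq0// mulr0 if_same ifF//; apply/negbTE.
  by rewrite notin_setE /= in_itv /= ltNge (le_trans v0) ?sqrtr_ge0.
rewrite pospow2E//; congr (if _ then _ else _).
have vE : Num.sqrt (v ^+ 2) = v by rewrite sqrtr_sqr gtr0_norm.
have av : (a < v ^+ 2) = (Num.sqrt a < v) by rewrite -{2}vE ltr_sqrt// exprn_gt0.
have vb : (v ^+ 2 <= b) = (v <= Num.sqrt b) by rewrite -{2}vE ler_sqrt// ltW.
by apply/idP/idP; rewrite !inE /= !in_itv /= av vb.
Qed.

(** The image of 2v dv under squaring charges only the positive half-line, so uniqueness of Lebesgue
    measure does not apply to it alone. Lebesgue measure on q <= 0 is added to complete it, and the
    factor [pospow 1 q], the indicator of q > 0, removes this addition from the integral. *)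
Lemma ge0_integral_sqr (g : R -> \bar R) :
  measurable_fun setT g -> (forall x, (0 <= g x)%E) ->
  (\int[mu]_q ((pospow 1 q)%:E * g q) =
   \int[mu]_v ((2 * pospow 2 v)%:E * g (v ^+ 2)%R))%E.
Proof.
move=> mg g0.
have m2 : measurable_fun setT (fun v : R => 2 * pospow 2 v).
  by apply: measurable_funM => //; exact: measurable_pospow.
have p2 v : 0 <= 2 * pospow 2 v :> R by rewrite mulr_ge0 ?pospow_ge0.
have [nu1 [nu1A nu1g]] := density_measure mu measurable_le0 (fun q => ler0n _ _).
have [nu2' [nu2'A nu2'g]] := density_measure mu m2 p2.
have msq : measurable_fun setT (fun v : measurableTypeR R => v ^+ 2 : measurableTypeR R).
  exact: exprn_measurable.
have [nu2 nu2E] := pushforward_measure_ex nu2' msq.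
have leb A : measurable A -> mu A = measure_add nu1 nu2 A.
  apply: lebesgue_measure_unique => X [[a b] _ <-] /=.
  have E1 x y : x < y -> y <= 0 -> mu `]x, y] = measure_add nu1 nu2 `]x, y].
    move=> xy y0; rewrite measure_addE nu1A nu2E /pushforward nu2'A.
    rewrite [X in (_ + X)%E]integral0_eq ?adde0; last first.
      move=> v /=; rewrite in_itv /= => /andP[_ vy].
      rewrite pospow_eq0 ?mulr0//.
      have : v ^+ 2 <= 0 by exact: le_trans y0.
      by rewrite -[v ^+ 2 <= 0]negbK -ltNge exprn_even_gt0//= negbK => /eqP ->.
    transitivity (\int[mu]_(q in `]x, y]) cst 1 q)%E.
      by rewrite integral_cst// mul1e.
    apply: eq_integral => q; rewrite inE /= in_itv /= => /andP[_ qy].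
    by rewrite (le_trans qy y0).
  have E2 x y : x < y -> 0 <= x -> mu `]x, y] = measure_add nu1 nu2 `]x, y].
    move=> xy x0; rewrite measure_addE nu1A nu2E /pushforward nu2'A.
    rewrite integral_sqr_preimage_itv// integral0_eq ?add0e; last first.
      move=> q /=; rewrite in_itv /= => /andP[xq _].
      by rewrite leNgt (le_lt_trans x0 xq).
    by rewrite lebesgue_measure_itv /= lte_fin xy.
  have [ab|ba] := ltP a b; last first.
    by rewrite set_itv_ge ?measure0// -leNgt bnd_simp.
  have [b0|b0] := leP b 0; first exact: E1.
  have [a0|a0] := leP 0 a; first exact: E2.
  have -> : `]a, b]%classic = `]a, 0] `|` `]0, b].
    by rewrite -itv_bndbnd_setU// bnd_simp ltW.
  have disj : `]a, 0] `&` `]0, b] = set0.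
    apply/seteqP; split => // x /= [].
    by rewrite !in_itv /= => /andP[_ h1] /andP[h2 _]; move: h2; rewrite ltNge h1.
  rewrite measureU// [RHS]measureU//; congr (_ + _)%E; [exact: E1|exact: E2].
transitivity (\int[measure_add nu1 nu2]_q ((pospow 1 q)%:E * g q))%E.
  by apply: eq_measure_integral => A mA _; exact: leb.
have mf : measurable_fun setT (fun q => (pospow 1 q)%:E * g q)%E.
  by apply: emeasurable_funM => //; apply/measurable_EFinP; exact: measurable_pospow.
have f0 q : (0 <= (pospow 1 q)%:E * g q)%E by rewrite mule_ge0// lee_fin pospow_ge0.
rewrite ge0_integral_measure_add// nu1g// integral0_eq ?add0e; last first.
  move=> q _; have [q0|q0] := leP q 0; last by rewrite mul0e.
  by rewrite pospow_eq0// mul0e mule0.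
transitivity (\int[nu2']_v ((pospow 1 (v ^+ 2)%R)%:E * g (v ^+ 2)%R))%E.
  apply: (ge0_integral_comp_measure_preserving msq) => // A mA.
  by rewrite nu2E.
rewrite nu2'g//; last first.
  by apply: (measurableT_comp mf); exact: exprn_measurable.
apply: eq_integral => v _; have [v0|v0] := leP v 0.
  by rewrite pospow_eq0// mulr0 !mul0e.
by rewrite pospow1E exprn_gt0// mul1e.
Qed.

Lemma ge0_integral_sqrt (g : R -> \bar R) :
  measurable_fun setT g -> (forall x, (0 <= g x)%E) ->
  (\int[mu]_q ((pospow 2^-1 q)%:E * g (Num.sqrt q)) =
   2%:E * \int[mu]_v ((pospow 1 v)%:E * g v))%E.
Proof.
move=> mg g0.
have mp a : measurable_fun setT (EFin \o @pospow R a).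
  by apply/measurable_EFinP; exact: measurable_pospow.
have p0 a x : (0 <= (@pospow R a x)%:E)%E by rewrite lee_fin pospow_ge0.
have msqrt : measurable_fun setT (@Num.sqrt R).
  by apply: continuous_measurable_fun; exact: sqrt_continuous.
rewrite -ge0_integralZl//; last 2 first.
- by apply: emeasurable_funM => //; exact: mp.
- by move=> v _; rewrite mule_ge0.
(* The indicator comes for free, since [pospow 2^-1] already vanishes for q <= 0. *)
transitivity (\int[mu]_q ((pospow 1 q)%:E * ((pospow 2^-1 q)%:E * g (Num.sqrt q))))%E.
  apply: eq_integral => q _; have [q0|q0] := leP q 0.
    by rewrite !pospow_eq0// !mul0e.
  by rewrite pospow1E q0 mul1e.
rewrite (@ge0_integral_sqr (fun q => (pospow 2^-1 q)%:E * g (Num.sqrt q))%E); last 2 first.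
- by apply: emeasurable_funM; [exact: mp|exact: measurableT_comp].
- by move=> q; rewrite mule_ge0.
apply: eq_integral => v _; have [v0|v0] := leP v 0.
  by rewrite (pospow_eq0 2 v0) (pospow_eq0 1 v0) mulr0 !mul0e mule0.
rewrite sqrtr_sqr gtr0_norm// muleA -EFinM pospow1E v0 mul1e; congr (_%:E * _)%E.
rewrite pospow2E// /pospow exprn_gt0//.
have -> : (v ^+ 2) `^ (2^-1 - 1) = v^-1.
  rewrite -powR_mulrn ?ltW// -powRrM (_ : _ * _ = -1) ?powR_inv1 ?ltW//.
  by field.
by rewrite mulfK// gt_eqF.
Qed.

End square.

(** * Planar changes of variables *)

Section planar.
Variable R : realType.
Local Notation mu := (@lebesgue_measure R).

Lemma measurable_invr : measurable_fun setT (@GRing.inv R).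
Proof.
rewrite (_ : @GRing.inv R = fun x => if 0 < x then x `^ (-1) else
    if x < 0 then - ((- x) `^ (-1)) else 0); last first.
  apply/funext => x; case: ltgtP => [x0|x0|<-]; last by rewrite invr0.
  - by rewrite powR_inv1 ?ltW.
  - by rewrite powR_inv1 ?oppr_ge0 ?ltW// invrN opprK.
apply: measurable_fun_ifT; [exact: measurable_fun_ltr|exact: measurable_powR|].
apply: measurable_fun_ifT => //; first exact: measurable_fun_ltr.
apply: measurableT_comp => //.
by apply: (@measurableT_comp _ _ _ _ _ _ (fun x : R => x `^ (-1))).
Qed.

Lemma measurable_lin2 (k l : R) : measurable_fun setT (fun p : R * R => k * p.1 + l * p.2).
Proof. by apply: measurable_funD; apply: measurable_funM. Qed.

Lemma ge0_integral_swap (f : R * R -> \bar R) :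
  measurable_fun setT f -> (forall x, (0 <= f x)%E) ->
  (\int[mu]_x \int[mu]_y f (x, y) = \int[mu]_y \int[mu]_x f (x, y))%E.
Proof.
exact: (@fubini_tonelli _ _ (measurableTypeR R) (measurableTypeR R) R mu mu f).
Qed.

Lemma measurable_integral1 (f : R * R -> \bar R) :
  measurable_fun setT f -> (forall x, (0 <= f x)%E) ->
  measurable_fun setT (fun x => \int[mu]_y f (x, y))%E.
Proof.
exact: (@measurable_fun_fubini_tonelli_F _ _ (measurableTypeR R) (measurableTypeR R) R mu f).
Qed.

Lemma measurable_integral2 (f : R * R -> \bar R) :
  measurable_fun setT f -> (forall x, (0 <= f x)%E) ->
  measurable_fun setT (fun y => \int[mu]_x f (x, y))%E.
Proof.
exact: (@measurable_fun_fubini_tonelli_G _ _ (measurableTypeR R) (measurableTypeR R) R mu f).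
Qed.

(** For nonzero a the rotation factors into two one-variable affine substitutions: u = (x + b v) / a
    at fixed v, then v = a y - b x at fixed x. Their Jacobians 1/|a| and |a| cancel, and a^2 + b^2 =
    1 turns the composite into u = a x + b y. *)
Lemma ge0_integral_rotation (a b : R) (f : R * R -> \bar R) :
  a ^+ 2 + b ^+ 2 = 1 -> measurable_fun setT f -> (forall x, (0 <= f x)%E) ->
  (\int[mu]_x \int[mu]_y f (a * x + b * y, a * y - b * x)%R =
   \int[mu]_u \int[mu]_v f (u, v))%E.
Proof.
move=> ab mf f0.
have mpair (F G : R -> R) (v : R) : measurable_fun setT F -> measurable_fun setT G ->
    measurable_fun setT (fun x => f (F x, G x)).
  by move=> mF mG; apply: (measurableT_comp mf); exact: measurable_fun_pair.
(* A quarter turn has no such factorization, but it only exchanges the axes up to sign. *)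
have [a0|aN0] := eqVneq a 0.
  have b1 : b ^+ 2 = 1 by rewrite -ab a0 expr0n add0r.
  have bN0 : b != 0 by apply: contra_eq_neq b1 => ->; rewrite expr0n eq_sym oner_eq0.
  have nb : `|b| = 1 by move/eqP: b1; rewrite sqrf_eq1 => /orP[] /eqP ->; rewrite ?normrN normr1.
  pose G (p : R * R) := f (p.2, - b * p.1 + 0).
  have G0 p : (0 <= G p)%E by exact: f0.
  have mG : measurable_fun setT G.
    apply: (measurableT_comp mf); apply: measurable_fun_pair => //.
    by apply: measurable_funD => //; apply: measurable_funM.
  transitivity (\int[mu]_x \int[mu]_u G (x, u))%E.
    apply: eq_integral => x _; rewrite [RHS](ge0_integral_affineN0 0 bN0); last 2 first.
    - by apply: (measurableT_comp mG); exact: measurable_fun_pair.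
    - by move=> ?; exact: f0.
    rewrite nb mul1e; apply: eq_integral => y _.
    by rewrite /G a0 !mul0r addr0 !add0r addr0 mulNr.
  rewrite (@ge0_integral_swap G)//; apply: eq_integral => u _.
  rewrite [RHS](ge0_integral_affineN0 0 (k := - b)) ?oppr_eq0//; last first.
    exact: mpair.
  by rewrite normrN nb mul1e.
pose G (p : R * R) := f (a^-1 * p.1 + a^-1 * b * p.2, p.2).
have G0 p : (0 <= G p)%E by exact: f0.
have mG : measurable_fun setT G.
  apply: (measurableT_comp mf); apply: measurable_fun_pair => //.
  exact: measurable_lin2.
rewrite [RHS](@ge0_integral_swap f)//.
have -> : (\int[mu]_v \int[mu]_u f (u, v) = \int[mu]_v (`|a^-1|%:E * \int[mu]_x G (x, v)))%E.
  apply: eq_integral => v _.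
  rewrite (ge0_integral_affineN0 (a^-1 * b * v) (k := a^-1)) ?invr_eq0//.
  exact: mpair.
rewrite ge0_integralZl//; last 2 first.
- by apply: measurable_integral2 => // ?; exact: f0.
- by move=> v _; apply: integral_ge0 => x _; exact: f0.
rewrite -(@ge0_integral_swap G)//.
have -> : (\int[mu]_x \int[mu]_y G (x, y) =
    \int[mu]_x (`|a|%:E * \int[mu]_y f (a * x + b * y, a * y - b * x)%R))%E.
  apply: eq_integral => x _.
  rewrite (ge0_integral_affineN0 (- b * x) aN0); last 2 first.
  - by apply: (measurableT_comp mG); exact: measurable_fun_pair.
  - by move=> ?; exact: f0.
  congr (_ * _)%E; apply: eq_integral => y _; rewrite /G /=; congr (f (_, _)).
  - rewrite -[X in a^-1 * X + _ = _]mul1r -ab.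
    by field.
  - by rewrite mulNr.
rewrite ge0_integralZl//; last 2 first.
- apply: (@measurable_integral1 (fun p => f (a * p.1 + b * p.2, a * p.2 - b * p.1))) => //.
  apply: (measurableT_comp mf); apply: measurable_fun_pair; first exact: measurable_lin2.
  by apply: measurable_funB; apply: measurable_funM.
- by move=> v _; apply: integral_ge0 => x _; exact: f0.
by rewrite muleA -EFinM -normrM mulVf// normr1 mul1e.
Qed.

(* The substitution [(x, y) = (s p, s (1 - p))] behind the Beta-Gamma relation. *)
Lemma ge0_integral_beta_gamma (a b : R) (h : R * R -> \bar R) :
  measurable_fun setT h -> (forall x, (0 <= h x)%E) ->
  (\int[mu]_x \int[mu]_y ((pospow a x * pospow b y)%:E * h (x + y, x / (x + y))%R) =
   \int[mu]_s \int[mu]_p ((pospow (a + b) s * (pospow a p * pospow b (1 - p)))%:E * h (s, p)))%E.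
Proof.
move=> mh h0.
(* The integrand in the coordinates x and s = x + y, reached by a translation at fixed x. *)
pose F (z : R * R) := ((pospow a z.1 * pospow b (z.2 - z.1))%:E * h (z.2, z.1 / z.2)%R)%E.
have mF : measurable_fun setT F.
  apply: emeasurable_funM.
    apply/measurable_EFinP/measurable_funM.
      by apply: (measurableT_comp (@measurable_pospow R a)).
    by apply: (measurableT_comp (@measurable_pospow R b)); exact: measurable_funB.
  apply: (measurableT_comp mh); apply: measurable_fun_pair => //.
  apply: measurable_funM => //.
  by apply: (measurableT_comp measurable_invr).
have F0 z : (0 <= F z)%E by rewrite mule_ge0// lee_fin mulr_ge0 ?pospow_ge0.
transitivity (\int[mu]_x \int[mu]_s F (x, s))%E.
  apply: eq_integral => x _.
  have mFx : measurable_fun setT (fun s => F (x, s)).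
    by apply: (measurableT_comp mF); exact: measurable_fun_pair.
  have := ge0_integral_affine x (@ltr01 R) mFx (fun s => F0 (x, s)).
  rewrite mul1e => ->.
  by apply: eq_integral => y _; rewrite /F /= mul1r addrK (addrC y).
transitivity (\int[mu]_s \int[mu]_x F (x, s))%E; first exact: ge0_integral_swap.
apply: eq_integral => s _.
(* For s <= 0 both sides vanish: x and s - x cannot both be positive. *)
have [s0|s0] := leP s 0.
  rewrite !integral0_eq// => [p _|x _]; first by rewrite pospow_eq0// mul0r mul0e.
  rewrite /F /=; have [x0|x0] := leP x 0.
    by rewrite pospow_eq0// mul0r mul0e.
  by rewrite (@pospow_eq0 _ b) ?mulr0 ?mul0e// subr_le0 (le_trans s0)// ltW.
rewrite (@ge0_integral_affine _ s 0)//; last first.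
  by apply: (measurableT_comp mF); exact: measurable_fun_pair.
rewrite -ge0_integralZl//; last 2 first.
- apply: (measurableT_comp mF); apply: measurable_fun_pair => //.
  exact: measurable_affine.
- by rewrite lee_fin ltW.
apply: eq_integral => p _; rewrite /F /= addr0 muleA -EFinM.
rewrite (_ : s - s * p = s * (1 - p)); last by ring.
have -> : s * p / s = p by rewrite mulrC mulKf// gt_eqF.
rewrite !pospowM//; congr (_%:E * _)%E.
(* The leading 1 in the exponent is the Jacobian s of x = s p. *)
rewrite /pospow s0 (_ : a + b - 1 = 1 + (a - 1) + (b - 1)); last by ring.
have pD u v : s `^ (u + v) = s `^ u * s `^ v by rewrite powRD// (gt_eqF s0) implybT.
rewrite (pD (1 + (a - 1))) (pD 1) (powRr1 (ltW s0)).
by ring.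
Qed.

End planar.

(** * Lebesgue measure on tuples *)

Section sigma_finite_measure.
Context (R : realType) (d : measure_display) (T : measurableType d).
Variables (m : {measure set T -> \bar R}) (h : sigma_finite setT m).

Let m' : set T -> \bar R := m.
HB.instance Definition _ := Measure.on m'.
HB.instance Definition _ := Measure_isSigmaFinite.Build d T R m' h.

(** Tonelli takes a bundled sigma-finite measure; this bundles a measure whose sigma-finiteness is
    established separately. *)
Lemma sigma_finite_measure_ex :
  exists nu : {sigma_finite_measure set T -> \bar R}, nu = m :> (set T -> \bar R).
Proof. by exists m'. Qed.

End sigma_finite_measure.

Section boxes.
Variable R : realType.
Local Notation mu := (@lebesgue_measure R).

Definition boxes n : set (set (n.-tuple R)) := [set A | exists a b, A = box a b].

Definition cube n (k : nat) : set (n.-tuple R) :=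
  box [tuple - k%:R | i < n] [tuple k%:R | i < n].

Arguments boxes : clear implicits.
Arguments cube : clear implicits.

Lemma boxes_setI n : setI_closed (boxes n).
Proof.
move=> _ _ [a [b ->]] [a' [b' ->]].
exists [tuple Num.max (tnth a i) (tnth a' i) | i < n],
  [tuple Num.min (tnth b i) (tnth b' i) | i < n].
apply/seteqP; split => [x [h h'] i|x h].
  by rewrite !tnth_mktuple ge_max le_min; move: (h i) (h' i) => /andP[-> ->] /andP[-> ->].
split=> i; move: (h i); rewrite !tnth_mktuple ge_max le_min;
  by move=> /andP[/andP[h1 h2] /andP[h3 h4]]; apply/andP.
Qed.

Lemma bigcup_cube n : \bigcup_k (cube n k) = setT.
Proof.
apply/seteqP; split => // x _.
pose M := \sum_(i < n) `|tnth x i|.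
have xM i : `|tnth x i| <= M.
  by rewrite /M (bigD1 i)//= lerDl; apply: sumr_ge0.
exists (Num.bound M) => // i; rewrite !tnth_mktuple -ler_norml.
rewrite (le_trans (xM i))// ltW//.
by apply: le_lt_trans (archi_boundP _); rewrite ?ler_norm//; apply: sumr_ge0.
Qed.

Lemma measurable_box n (a b : n.-tuple R) : measurable (box a b).
Proof.
have -> : box a b = \bigcap_(i in [set: 'I_n])
    ((fun x : n.-tuple R => tnth x i) @^-1` `[tnth a i, tnth b i]).
  apply/seteqP; split => [x h i _|x h i] /=; first by rewrite in_itv /= h.
  by have := h i I; rewrite /= in_itv.
apply: fin_bigcap_measurable => // i _.
rewrite -[X in measurable X]setTI; exact: measurable_tnth.
Qed.

(** Coordinates generate the product sigma-algebra and the rays [[y, +oo[] the Borel sets, so it is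
    enough to write the preimage of a ray under a coordinate as a countable union of boxes. *)
Lemma measurable_sub_boxes n : (measurable : set (set (n.-tuple R))) `<=` <<s boxes n >>.
Proof.
apply: smallest_sub; first exact: smallest_sigma_algebra.
rewrite -bigcup_seq => A /= [i _].
suff mi : measurable_fun setT
    ((fun x => tnth x i) : g_sigma_algebraType (boxes n) -> measurableTypeR R).
  by move=> [Y mY <-]; exact: mi.
have mE : @measurable _ (measurableTypeR R) = <<s @RGenCInfty.G R >>.
  exact: RGenCInfty.measurableE.
apply: (@measurability _ _ (g_sigma_algebraType (boxes n)) (measurableTypeR R)
  setT (fun x => tnth x i) _ mE) => _ [_ [y ->] <-].
rewrite setTI.
pose a k := [tuple if j == i then y else - k%:R | j < n].
have -> : (fun x : n.-tuple R => tnth x i) @^-1` `[y, +oo[ =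
    \bigcup_k (box (a k) [tuple k%:R | j < n]).
  apply/seteqP; split => [x|x [k _ /(_ i)]]; last first.
    by rewrite !tnth_mktuple eqxx /= in_itv /= andbT => /andP[].
  rewrite /= in_itv /= andbT => yx.
  have [k _ xk] : (\bigcup_k cube n k) x by rewrite bigcup_cube.
  exists k => // j; have := xk j; rewrite !tnth_mktuple.
  by case: eqP => // -> /andP[_ ->]; rewrite yx.
apply: bigcupT_measurable => k; apply: sub_sigma_algebra.
by exists (a k), [tuple k%:R | j < n].
Qed.

Lemma is_lebesgue_box0 n (lam : {measure set (n.-tuple R) -> \bar R}) a b :
  (exists i, tnth b i < tnth a i) -> lam (box a b) = 0%E.
Proof.
move=> [i ba]; suff -> : box a b = set0 by rewrite measure0.
apply/seteqP; split => // x /(_ i) /andP[ax xb].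
by move: ba; rewrite ltNge (le_trans ax xb).
Qed.

Lemma is_lebesgue_cube n (lam : {measure set (n.-tuple R) -> \bar R}) k :
  is_lebesgue lam -> (lam (cube n k) < +oo)%E.
Proof.
move=> h; rewrite h ?ltry// => i.
by rewrite !tnth_mktuple (le_trans (_ : _ <= 0))// oppr_le0.
Qed.

(** Boxes generate and are stable under intersection, and cubes of finite measure exhaust the space.
    An arbitrary [lam] can thus be traded for a product construction. *)
Lemma is_lebesgue_unique n (l1 l2 : {measure set (n.-tuple R) -> \bar R}) A :
  is_lebesgue l1 -> is_lebesgue l2 -> measurable A -> l1 A = l2 A.
Proof.
move=> h1 h2 mA.
apply: (g_sigma_algebra_measure_unique (boxes n) _ (cube n)) => //.
- by move=> _ [a [b ->]]; exact: measurable_box.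
- by move=> k; do 2 eexists.
- exact: bigcup_cube.
- exact: boxes_setI.
- move=> _ [a [b ->]].
  have [ab|] := pselect (forall i, tnth a i <= tnth b i); first by rewrite h1// h2.
  move=> /existsNP[i /negP]; rewrite -ltNge => ba.
  by rewrite !is_lebesgue_box0//; exists i.
- by move=> k; exact: is_lebesgue_cube.
- exact: measurable_sub_boxes.
Qed.

Lemma is_lebesgue_sigma_finite n (lam : {measure set (n.-tuple R) -> \bar R}) :
  is_lebesgue lam -> sigma_finite setT lam.
Proof.
move=> h; exists (cube n); first by rewrite bigcup_cube.
by move=> k; split; [exact: measurable_box|exact: is_lebesgue_cube].
Qed.

Lemma tnth_behead_lift n (c : n.+1.-tuple R) j :
  tnth [tuple of behead c] j = tnth c (lift ord0 j).
Proof. by rewrite [in RHS](tuple_eta c) tnthS. Qed.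

Definition consp n (p : R * n.-tuple R) : n.+1.-tuple R := [tuple of p.1 :: p.2].

Lemma measurable_consp n : measurable_fun setT (@consp n).
Proof. exact: measurable_cons. Qed.

Lemma is_lebesgue_product n (lam : {sigma_finite_measure set (n.-tuple R) -> \bar R})
    (nu : {measure set (n.+1.-tuple R) -> \bar R}) : is_lebesgue lam ->
  nu = pushforward (mu \x lam)%E (@consp n) :> (set _ -> _) -> is_lebesgue nu.
Proof.
move=> h nuE a b ab; rewrite nuE /pushforward.
have -> : @consp n @^-1` box a b = `[tnth a ord0, tnth b ord0] `*`
    box [tuple of behead a] [tuple of behead b].
  apply/seteqP; split => [[x t] /= hx|[x t] [/= hx ht] i].
    split; first by have := hx ord0; rewrite tnth0 /= in_itv.
    by move=> j; have := hx (lift ord0 j); rewrite tnthS !tnth_behead_lift.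
  have [j ->|->] := unliftP ord0 i.
    by have := ht j; rewrite tnthS !tnth_behead_lift.
  by rewrite tnth0; move: hx; rewrite in_itv.
rewrite product_measure1E//; last exact: measurable_box.
rewrite h; last by move=> j; rewrite !tnth_behead_lift.
rewrite big_ord_recl EFinM; congr (_ * _)%E; last first.
  by congr (_%:E); apply: eq_bigr => j _; rewrite !tnth_behead_lift.
apply: (eq_trans (lebesgue_measure_itv `[tnth a ord0, tnth b ord0])).
rewrite /= lte_fin; case: ltP => // ba; apply/esym; congr EFin; apply/eqP; rewrite subr_eq0 eq_le ba.
by rewrite ab.
Qed.

Lemma is_lebesgue_ex n : exists lam : {sigma_finite_measure set (n.-tuple R) -> \bar R},
  is_lebesgue lam.
Proof.
have sf m (l : {measure set (m.-tuple R) -> \bar R}) : is_lebesgue l ->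
    exists lam : {sigma_finite_measure set (m.-tuple R) -> \bar R}, is_lebesgue lam.
  move=> h; have [nu nuE] := sigma_finite_measure_ex (is_lebesgue_sigma_finite h).
  by exists nu => a b ab; rewrite nuE h.
elim: n => [|n [lam h]].
  apply: (sf 0 (dirac [tuple])) => a b _.
  rewrite big_ord0; have : box a b [tuple] by move=> [].
  by move/mem_set => ab; rewrite /= /dirac /= indicE ab.
have [nu nuE] := pushforward_measure_ex (mu \x lam)%E (@measurable_consp n).
exact/(sf _ nu)/(is_lebesgue_product h).
Qed.

(** By uniqueness [nu] is the image of the product measure, however it was built, so Tonelli splits
    off the first coordinate. *)
Lemma ge0_integral_lebesgue_cons n (lam : {sigma_finite_measure set (n.-tuple R) -> \bar R})
    (nu : {measure set (n.+1.-tuple R) -> \bar R}) (f : n.+1.-tuple R -> \bar R) :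
  is_lebesgue lam -> is_lebesgue nu ->
  measurable_fun setT f -> (forall x, (0 <= f x)%E) ->
  (\int[nu]_y f y = \int[mu]_x \int[lam]_t f (consp (x, t)))%E.
Proof.
move=> h h' mf f0.
have [nu' nu'E] := pushforward_measure_ex (mu \x lam)%E (@measurable_consp n).
have hn := is_lebesgue_product h nu'E.
transitivity (\int[(mu \x lam)%E]_p f (consp p))%E.
  apply: ge0_integral_comp_measure_preserving => //; first exact: measurable_consp.
  by move=> A mA; rewrite (is_lebesgue_unique h' hn mA) nu'E.
have mfc : measurable_fun setT (fun p => f (@consp n p)).
  by apply: (measurableT_comp mf); exact: measurable_consp.
exact: (@fubini_tonelli1 _ _ (measurableTypeR R) (n.-tuple R) R mu lam
  (fun p => f (consp p)) mfc).
Qed.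

End boxes.

(** * Symmetrization on the line *)

Lemma measurable_comp2 (d d1 d2 d3 : measure_display) (T : measurableType d)
    (T1 : measurableType d1) (T2 : measurableType d2) (T3 : measurableType d3)
    (f : T1 * T2 -> T3) (F : T -> T1) (G : T -> T2) :
  measurable_fun setT f -> measurable_fun setT F -> measurable_fun setT G ->
  measurable_fun setT (fun x => f (F x, G x)).
Proof. by move=> mf mF mG; apply: (measurableT_comp mf); exact: measurable_fun_pair. Qed.

Section even.
Variable R : realType.
Local Notation mu := (@lebesgue_measure R).

Lemma measurable_EFin_pospow (a : R) : measurable_fun setT (fun x => (pospow a x)%:E).
Proof. by apply/measurable_EFinP; exact: measurable_pospow. Qed.

Lemma ge0_integral_symmetrize (g : R -> \bar R) :
  measurable_fun setT g -> (forall x, (0 <= g x)%E) ->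
  (\int[mu]_v g v = \int[mu]_v ((pospow 1 v)%:E * (g v + g (- v)%R)))%E.
Proof.
move=> mg g0.
have mp : measurable_fun setT (fun v : R => (pospow 1 v)%:E * g v)%E.
  by apply: emeasurable_funM => //; exact: measurable_EFin_pospow.
have mn : measurable_fun setT (fun v : R => (pospow 1 v)%:E * g (- v)%R)%E.
  apply: emeasurable_funM; first exact: measurable_EFin_pospow.
  by apply: (measurableT_comp mg).
have p0 (x v : R) : (0 <= (pospow 1 x)%:E * g v)%E.
  by rewrite mule_ge0// lee_fin pospow_ge0.
have mpN : measurable_fun setT (fun v : R => (pospow 1 (- v))%:E * g v)%E.
  apply: emeasurable_funM => //.
  by apply: (measurableT_comp (@measurable_EFin_pospow 1)).
transitivity (\int[mu]_v ((pospow 1 v)%:E * g v + (pospow 1 (- v))%:E * g v))%E.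
  (* Equality holds only almost everywhere: both weights vanish at v = 0. *)
  apply: ge0_ae_eq_integral => //.
  - exact: emeasurable_funD.
  - by move=> v _; rewrite adde_ge0.
  - exists [set 0]; split => //; first exact: lebesgue_measure_set1.
    move=> v /= h; apply: contrapT => v0; apply: h => _.
    rewrite !pospow1E oppr_gt0; case: (ltgtP v 0) v0 => [vn|vp|->] // _;
      by rewrite ?mul1e ?mul0e ?add0e ?adde0.
transitivity (\int[mu]_v ((pospow 1 v)%:E * g v) + \int[mu]_v ((pospow 1 v)%:E * g (- v)%R))%E.
  rewrite ge0_integralD; [|by []|by move=> v _; exact: p0|by []|by move=> v _; exact: p0|by []].
  rewrite [X in (_ + X)%E = _](ge0_integral_opp mpN); last by move=> v; exact: p0.
  under [X in (_ + X)%E = _]eq_integral do rewrite opprK.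
  by [].
rewrite -ge0_integralD; [|by []|by move=> v _; exact: p0|by []|by move=> v _; exact: p0|by []].
apply: eq_integral => v _.
by rewrite ge0_muleDr.
Qed.

Lemma ge0_integral_sqrt_symmetrize (g : R -> \bar R) :
  measurable_fun setT g -> (forall x, (0 <= g x)%E) ->
  (\int[mu]_v g v = 2^-1%:E *
   \int[mu]_q ((pospow 2^-1 q)%:E * (g (Num.sqrt q) + g (- Num.sqrt q)%R)))%E.
Proof.
move=> mg g0.
rewrite (@ge0_integral_sqrt _ (fun v => g v + g (- v)%R)%E); last 2 first.
- by apply: emeasurable_funD => //; apply: (measurableT_comp mg).
- by move=> v; rewrite adde_ge0.
by rewrite muleA -EFinM mulVf// mul1e ge0_integral_symmetrize.
Qed.

Lemma ge0_integral_comp_sqr (g : R -> \bar R) :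
  measurable_fun setT g -> (forall x, (0 <= g x)%E) ->
  (\int[mu]_v g (v ^+ 2)%R = \int[mu]_q ((pospow 2^-1 q)%:E * g q))%E.
Proof.
move=> mg g0; rewrite ge0_integral_sqrt_symmetrize//; last first.
  by apply: (measurableT_comp mg).
have mpg : measurable_fun setT (fun q : R => (pospow 2^-1 q)%:E * g q)%E.
  by apply: emeasurable_funM => //; exact: measurable_EFin_pospow.
have pg0 (q : R) : (0 <= (pospow 2^-1 q)%:E * g q)%E.
  by rewrite mule_ge0// lee_fin pospow_ge0.
transitivity (2^-1%:E * \int[mu]_q (2%:E * ((pospow 2^-1 q)%:E * g q)))%E.
  congr (_ * _)%E; apply: eq_integral => q _.
  have [q0|q0] := leP q 0; first by rewrite pospow_eq0// !mul0e mule0.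
  by rewrite sqrrN sqr_sqrtr ?ltW// [RHS]muleCA mule_natl mule2n.
by rewrite ge0_integralZl// muleA -EFinM mulVf// mul1e.
Qed.

End even.

(** * Joint law of a coordinate and the squared norm *)

Section joint_law.
Variable R : realType.
Local Notation mu := (@lebesgue_measure R).

Lemma dotv_consp n (m : n.+1.-tuple R) x t :
  dotv m (consp (x, t)) = tnth m ord0 * x + dotv [tuple of behead m] t.
Proof.
rewrite /dotv big_ord_recl tnth0; congr (_ + _); apply: eq_bigr => i _.
by rewrite tnth_behead_lift tnthS.
Qed.

Lemma dotv_cons2 n (m : n.+1.-tuple R) :
  dotv m m = tnth m ord0 ^+ 2 + dotv [tuple of behead m] [tuple of behead m].
Proof.
rewrite /dotv big_ord_recl expr2; congr (_ + _); apply: eq_bigr => i _.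
by rewrite tnth_behead_lift.
Qed.

Lemma dotv_consp2 n x (t : n.-tuple R) :
  dotv (consp (x, t)) (consp (x, t)) = x ^+ 2 + dotv t t.
Proof.
rewrite /dotv big_ord_recl tnth0 expr2; congr (_ + _); apply: eq_bigr => i _.
by rewrite tnthS.
Qed.

Lemma dotvv_ge0 n (m : n.-tuple R) : 0 <= dotv m m.
Proof. by apply: sumr_ge0 => i _; rewrite -expr2 sqr_ge0. Qed.

Lemma measurable_dotv n d (T : measurableType d) (f g : T -> n.-tuple R) :
  measurable_fun setT f -> measurable_fun setT g ->
  measurable_fun setT (fun y => dotv (f y) (g y)).
Proof.
move=> mf mg; apply: measurable_sum => i; apply: measurable_funM.
- by apply: (measurableT_comp (measurable_tnth i)).
- by apply: (measurableT_comp (measurable_tnth i)).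
Qed.

(** Applied below to the tail of a unit vector, which is 0 when that vector is plus or minus the
    first basis vector; the scalar factor is then 0 and any unit vector serves. *)
Lemma dotv_normalize n (m : n.+1.-tuple R) : exists2 nu : n.+1.-tuple R,
  sphere nu & forall t, dotv m t = Num.sqrt (dotv m m) * dotv nu t.
Proof.
have [m0|m0] := eqVneq (dotv m m) 0.
  have mi i : tnth m i = 0.
    have : dotv m m <= 0 by rewrite m0.
    rewrite /dotv (bigD1 i)//= => h.
    have s0 : 0 <= \sum_(j < n.+1 | j != i) tnth m j * tnth m j.
      by apply: sumr_ge0 => j _; rewrite -expr2 sqr_ge0.
    have : tnth m i ^+ 2 <= 0 by rewrite expr2; apply: le_trans h; rewrite lerDl.
    by rewrite -[_ <= 0]negbK -ltNge exprn_even_gt0//= negbK => /eqP.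
  exists [tuple (if i == ord0 then 1 else 0) | i < n.+1].
    rewrite /sphere /= /dotv big_ord_recl !tnth_mktuple eqxx mulr1.
    by rewrite big1 ?addr0// => j _; rewrite !tnth_mktuple /= mulr0.
  move=> t; rewrite m0 sqrtr0 mul0r /dotv big1// => i _.
  by rewrite mi mul0r.
have s0 : Num.sqrt (dotv m m) != 0.
  by rewrite sqrtr_eq0 -ltNge lt_def m0 dotvv_ge0.
exists [tuple tnth m i / Num.sqrt (dotv m m) | i < n.+1].
  rewrite /sphere /=; transitivity (dotv m m / Num.sqrt (dotv m m) ^+ 2).
    rewrite /dotv mulr_suml; apply: eq_bigr => i _; rewrite !tnth_mktuple.
    by rewrite expr2 invfM; ring.
  by rewrite sqr_sqrtr ?dotvv_ge0// divff.
move=> t; rewrite /dotv mulr_sumr; apply: eq_bigr => i _.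
rewrite !tnth_mktuple mulrA mulrCA divff// mulr1//.
Qed.

(* The law of (m.y, |y|^2 - (m.y)^2) under Lebesgue measure is the product of
   Lebesgue measure and w^(k-1) dw, up to a factor [c]. This factor is allowed
   to be infinite: its finiteness follows in the end from P having mass 1. *)
Definition joint_law n (k : R) (c : \bar R) :=
  forall (lam : {measure set (n.-tuple R) -> \bar R}) (m : n.-tuple R)
    (f : R * R -> \bar R),
  is_lebesgue lam -> sphere m -> measurable_fun setT f -> (forall x, (0 <= f x)%E) ->
  (\int[lam]_y f (dotv m y, dotv y y) =
   c * \int[mu]_u \int[mu]_w ((pospow k w)%:E * f (u, u ^+ 2 + w)%R))%E.

(** One rotation gives the coordinates along and across [m]. Here w is the square of the latter,
    distributed as q^(-1/2) dq, hence the parameter 1/2 and the factor 1. *)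
Lemma joint_law2 : joint_law 2 2^-1 1.
Proof.
move=> lam m f hlam hm mf f0.
have [l0 h0] := is_lebesgue_ex R 0.
have [l1 h1] := is_lebesgue_ex R 1.
have mg : measurable_fun setT (fun y : 2.-tuple R => f (dotv m y, dotv y y)).
  by apply: measurable_comp2 => //; apply: measurable_dotv.
rewrite (ge0_integral_lebesgue_cons h1 hlam mg)//.
have l0T : l0 setT = 1%E.
  have := h0 [tuple] [tuple]; rewrite big_ord0 => <-; last by case.
  by congr (l0 _); apply/seteqP; split => // x _ [].
pose a := tnth m ord0; pose b := tnth m (lift ord0 ord0).
have ab : a ^+ 2 + b ^+ 2 = 1.
  have := hm; rewrite /sphere /= dotv_cons2 -/a => <-; congr (_ + _).
  by rewrite dotv_cons2 tnth_behead_lift /dotv big_ord0 addr0.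
pose F (p : R * R) := f (p.1, p.1 ^+ 2 + p.2 ^+ 2).
have mF : measurable_fun setT F.
  by apply: measurable_comp2 => //; apply: measurable_funD; apply: measurable_funX.
have F0 p : (0 <= F p)%E by exact: f0.
transitivity (\int[mu]_x \int[mu]_y F (a * x + b * y, a * y - b * x)%R)%E.
  apply: eq_integral => x _.
  have mgx : measurable_fun setT (fun t : 1.-tuple R => f (dotv m (consp (x, t)), dotv (consp (x, t)) (consp (x, t)))).
    apply: (measurableT_comp mg).
    by apply: (measurableT_comp (@measurable_consp R 1)); exact: measurable_fun_pair.
  rewrite (ge0_integral_lebesgue_cons h0 h1 mgx)//.
  apply: eq_integral => y _.
  transitivity (\int[l0]_t cst (F (a * x + b * y, a * y - b * x)%R) t)%E; last first.
    by rewrite integral_cst// l0T mule1.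
  apply: eq_integral => t _; rewrite /F /= !dotv_consp2 !dotv_consp tnth_behead_lift.
  rewrite /dotv !big_ord0 !addr0; congr (f (_, _)).
  rewrite -/a -/b -[x ^+ 2 + y ^+ 2]mul1r -ab; ring.
rewrite (ge0_integral_rotation ab mF F0) mul1e; apply: eq_integral => u _.
rewrite -(@ge0_integral_comp_sqr _ (fun w => f (u, u ^+ 2 + w)))//.
by apply: measurable_comp2 => //; apply: measurable_funD.
Qed.

(** The new factor B(k, 1/2) is the integral over p that separates when w^(k-1) dw and q^(-1/2) dq
    are convolved, since the integrand sees only w + q. *)
Lemma joint_lawS n (k : R) (c : \bar R) : (0 <= c)%E -> joint_law n.+1 k c ->
  joint_law n.+2 (k + 2^-1)
    (c * \int[mu]_p (pospow k p * pospow 2^-1 (1 - p))%:E).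
Proof.
move=> c0 ih lam m f hlam hm mf f0.
have [l1 h1] := is_lebesgue_ex R n.+1.
have mg : measurable_fun setT (fun y : n.+2.-tuple R => f (dotv m y, dotv y y)).
  by apply: measurable_comp2 => //; apply: measurable_dotv.
rewrite (ge0_integral_lebesgue_cons h1 hlam mg)//.
pose m' := [tuple of behead m].
have [nu hnu nuE] := dotv_normalize m'.
pose a := tnth m ord0; pose b := Num.sqrt (dotv m' m').
have ab : a ^+ 2 + b ^+ 2 = 1.
  by rewrite sqr_sqrtr ?dotvv_ge0// -dotv_cons2.
(* The arguments are ((u, v), w), with v the leftover coordinate of the plane and w the part of
   |t|^2 orthogonal to [nu]. *)
pose J (p : (R * R) * R) := ((pospow k p.2)%:E *
  f (p.1.1, p.1.1 ^+ 2 + p.1.2 ^+ 2 + p.2)%R)%E.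
have mJ : measurable_fun setT J.
  apply: emeasurable_funM.
    by apply: (measurableT_comp (@measurable_EFin_pospow R k)).
  apply: measurable_comp2 => //; first exact: measurableT_comp.
  apply: measurable_funD => //.
  by apply: measurable_funD; apply: measurable_funX; exact: measurableT_comp.
have J0 p : (0 <= J p)%E by rewrite mule_ge0// lee_fin pospow_ge0.
pose K (p : R * R) := (\int[mu]_w J (p, w))%E.
have mK : measurable_fun setT K.
  exact: (@measurable_fun_fubini_tonelli_F _ _ _ (measurableTypeR R) R mu J).
have K0 p : (0 <= K p)%E by exact: integral_ge0.
(* Here s stands for nu.t. As (a, b) is a unit vector, u = a x + b s and v = a s - b x satisfy u^2 +
   v^2 = x^2 + s^2. *)
transitivity (\int[mu]_x (c * \int[mu]_s K (a * x + b * s, a * s - b * x)%R))%E.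
  apply: eq_integral => x _.
  have mfx : measurable_fun setT (fun p : R * R => f (a * x + b * p.1, x ^+ 2 + p.2)).
    by apply: measurable_comp2 => //; apply: measurable_funD => //; apply: measurable_funM.
  transitivity (\int[l1]_t f (a * x + b * dotv nu t, x ^+ 2 + dotv t t)%R)%E.
    by apply: eq_integral => t _; rewrite dotv_consp2 dotv_consp nuE.
  apply: (eq_trans (ih _ _ _ h1 hnu mfx (fun p => f0 _))).
  congr (_ * _)%E; apply: eq_integral => s _; apply: eq_integral => w _.
  rewrite /J /=; congr (_ * f (_, _))%E.
  rewrite addrA; congr (_ + _).
  by rewrite -[x ^+ 2 + s ^+ 2]mul1r -ab; ring.
rewrite ge0_integralZl//; last 2 first.
- apply: (@measurable_integral1 _ (fun p => K (a * p.1 + b * p.2, a * p.2 - b * p.1))) => //.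
  apply: measurable_comp2 => //; first exact: measurable_lin2.
  by apply: measurable_funB; apply: measurable_funM.
- by move=> x _; exact: integral_ge0.
rewrite (ge0_integral_rotation ab mK K0) -muleA; congr (_ * _)%E.
pose B := (\int[mu]_p (pospow k p * pospow 2^-1 (1 - p))%:E)%E.
have mB : measurable_fun setT (fun p : R => (pospow k p * pospow 2^-1 (1 - p))%:E).
  apply/measurable_EFinP/measurable_funM; first exact: measurable_pospow.
  by apply: (measurableT_comp (@measurable_pospow R 2^-1)); exact: measurable_funB.
have B0 : (0 <= B)%E.
  by apply: integral_ge0 => p _; rewrite lee_fin mulr_ge0 ?pospow_ge0.
rewrite -/B -ge0_integralZl//; last 2 first.
- apply: (@measurable_integral1 _ (fun p => (pospow (k + 2^-1) p.2)%:E * f (p.1, p.1 ^+ 2 + p.2)%R)%E).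
    apply: emeasurable_funM.
      by apply: (measurableT_comp (@measurable_EFin_pospow R (k + 2^-1))).
    by apply: measurable_comp2 => //; apply: measurable_funD => //; apply: measurable_funX.
  by move=> p; rewrite mule_ge0// lee_fin pospow_ge0.
- by move=> u _; apply: integral_ge0 => w _; rewrite mule_ge0// lee_fin pospow_ge0.
apply: eq_integral => u _.
have mfu : measurable_fun setT (fun p : R * R => f (u, u ^+ 2 + p.1)).
  by apply: measurable_comp2 => //; apply: measurable_funD.
transitivity (\int[mu]_w \int[mu]_v J ((u, v), w))%E.
  apply: (@ge0_integral_swap _ (fun p => J ((u, p.1), p.2))) => //.
  by apply: measurable_comp2 => //; apply: measurable_fun_pair.
transitivity (\int[mu]_w \int[mu]_q
    ((pospow k w * pospow 2^-1 q)%:E * f (u, u ^+ 2 + (w + q))%R))%E.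
  apply: eq_integral => w _; rewrite /J /=.
  have mw : measurable_fun setT (fun v : R => f (u, u ^+ 2 + (w + v))).
    by apply: measurable_comp2 => //; do 2 apply: measurable_funD => //.
  rewrite ge0_integralZl//; last 2 first.
  - apply: measurable_comp2 => //; apply: measurable_funD => //.
    by apply: measurable_funD => //; apply: measurable_funX.
  - by rewrite lee_fin pospow_ge0.
  under [RHS]eq_integral do rewrite EFinM -muleA.
  rewrite [RHS]ge0_integralZl//; last 3 first.
  - by apply: emeasurable_funM => //; exact: measurable_EFin_pospow.
  - by move=> q _; rewrite mule_ge0// lee_fin pospow_ge0.
  - by rewrite lee_fin pospow_ge0.
  rewrite -(ge0_integral_comp_sqr mw)//; congr (_ * _)%E.
  by apply: eq_integral => v _; congr (f (_, _)); ring.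
rewrite (@ge0_integral_beta_gamma _ k 2^-1 (fun p => f (u, u ^+ 2 + p.1)))//.
rewrite -ge0_integralZl//; last 2 first.
- apply: emeasurable_funM; first exact: measurable_EFin_pospow.
  by apply: measurable_comp2 => //; apply: measurable_funD.
- by move=> w _; rewrite mule_ge0// lee_fin pospow_ge0.
apply: eq_integral => s _ /=.
under eq_integral do rewrite EFinM muleAC.
rewrite ge0_integralZl// ?mule_ge0 ?lee_fin ?pospow_ge0//; last first.
  by move=> p _; rewrite lee_fin mulr_ge0 ?pospow_ge0.
by rewrite muleC.
Qed.

Lemma joint_law_ex n : exists2 c : \bar R, (0 <= c)%E & joint_law n.+2 (n.+1%:R / 2) c.
Proof.
elim: n => [|n [c c0 ih]].
  by exists 1%E => //; rewrite div1r; exact: joint_law2.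
have := joint_lawS c0 ih.
rewrite (_ : n.+1%:R / 2 + 2^-1 = n.+2%:R / 2); last by rewrite -[n.+2]addn1 natrD; field.
move=> h; eexists; last exact: h.
rewrite mule_ge0//; apply: integral_ge0 => p _.
by rewrite lee_fin mulr_ge0 ?pospow_ge0.
Qed.

End joint_law.

(** * The Beta-Gamma relation *)

Section gamma_beta.
Variable R : realType.
Local Notation mu := (@lebesgue_measure R).

(** Kept extended real because [Gammaf] sends a divergent integral to 0, which would spoil the
    product formula. *)
Definition egamma (a : R) : \bar R := (\int[mu]_t (pospow a t * expR (- t))%:E)%E.

Definition ebeta (a b : R) : \bar R :=
  (\int[mu]_z (pospow a z * pospow b (1 - z))%:E)%E.

Lemma measurable_egamma_integrand (a : R) :
  measurable_fun setT (fun t : R => pospow a t * expR (- t)).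
Proof.
apply: measurable_funM; first exact: measurable_pospow.
by apply: measurableT_comp => //; exact: measurable_expR.
Qed.

Lemma egamma_integrand_ge0 (a t : R) : 0 <= pospow a t * expR (- t).
Proof. by rewrite mulr_ge0 ?pospow_ge0 ?expR_ge0. Qed.

Lemma Gammaf_egamma (a : R) : Gammaf a = fine (egamma a).
Proof.
rewrite /Gammaf /Rintegral /egamma integral_mkcond; congr fine.
apply: eq_integral => t _; rewrite patchE; have [t0|t0] := ltP 0 t.
  by rewrite mem_set /= ?in_itv /= ?t0// /pospow t0.
by rewrite memNset /= ?pospow_eq0 ?mul0r// in_itv /= ltNge t0.
Qed.

Lemma egamma_gt0 (a : R) : (0 < egamma a)%E.
Proof.
have g0 : (0 <= egamma a)%E.
  by apply: integral_ge0 => t _; rewrite lee_fin egamma_integrand_ge0.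
rewrite lt_def g0 andbT; apply/negP => /eqP e0.
have mE : measurable_fun setT (fun t : R => (pospow a t * expR (- t))%:E).
  by apply/measurable_EFinP; exact: measurable_egamma_integrand.
have /(ae_eq_integral_abs mu measurableT mE) : (\int[mu]_t `|(pospow a t * expR (- t))%:E| = 0)%E.
  rewrite -[RHS]e0; apply: eq_integral => t _.
  by rewrite gee0_abs// lee_fin egamma_integrand_ge0.
move=> [N [mN N0 sub]].
have : (mu `]0%R, 1%R]%classic <= mu N)%E.
  apply: le_measure; rewrite ?inE// => t; rewrite /= in_itv /= => /andP[t0 _].
  apply: sub => /= /(_ I) /eqP; rewrite eqe mulf_eq0 gt_eqF ?pospow_gt0//=.
  by rewrite gt_eqF ?expR_gt0.
by rewrite N0 leNgt lebesgue_measure_itv /= lte_fin ltr01 oppr0 adde0 lte_fin ltr01.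
Qed.

(** From x <= e^x at x = t / (2a), raised to the power a - 1 >= 0, one gets t^(a-1) <= (2a)^(a-1)
    e^(t/2), so e^(-t/2) dominates. The factor 2 in [2 * K] undoes the normalization of the
    exponential density of rate 1/2. *)
Lemma egamma_lty (a : R) : 1 <= a -> (egamma a < +oo)%E.
Proof.
move=> a1; have a0 : 0 < a by exact: lt_le_trans a1.
pose K := (2 * a) `^ (a - 1).
have K0 : 0 <= K by exact: powR_ge0.
apply: (@le_lt_trans _ _ (\int[mu]_t ((2 * K)%:E * (exponential_pdf 2^-1 t)%:E))%E).
  apply: ge0_le_integral => //.
  - by move=> t _; rewrite lee_fin egamma_integrand_ge0.
  - by apply/measurable_EFinP; exact: measurable_egamma_integrand.
  - apply: emeasurable_funM => //; apply/measurable_EFinP.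
    exact: measurable_exponential_pdf.
  - move=> t _; rewrite -EFinM lee_fin.
    have [t0|t0] := leP t 0.
      rewrite pospow_eq0// mul0r mulr_ge0// ?mulr_ge0// exponential_pdf_ge0//.
    rewrite (exponential_pdfE _ (ltW t0)).
    have -> : 2 * K * (2^-1 * expR (- 2^-1 * t)) = K * expR (- 2^-1 * t) by field.
    have -> : expR (- t) = expR (- 2^-1 * t) * expR (- 2^-1 * t).
      by rewrite -expRD; congr expR; field.
    rewrite mulrA ler_wpM2r ?expR_ge0//.
    rewrite /pospow t0.
    have M0 : 0 < 2 * a by rewrite mulr_gt0.
    have -> : t `^ (a - 1) = K * (t / (2 * a)) `^ (a - 1).
      by rewrite -powRM ?divr_ge0 ?ltW//; congr (_ `^ _); field; rewrite gt_eqF.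
    rewrite -mulrA ler_piMr//.
    have h : (t / (2 * a)) `^ (a - 1) <= expR (2^-1 * t).
      apply: (@le_trans _ _ (expR (t / (2 * a)) `^ (a - 1))).
        have q0 : 0 <= t / (2 * a) by rewrite divr_ge0// ltW.
        have q1 : t / (2 * a) <= expR (t / (2 * a)).
          by apply: le_trans (expR_ge1Dx _); rewrite lerDr.
        by apply: ge0_ler_powR; rewrite ?nnegrE ?subr_ge0 ?expR_ge0.
      rewrite -expRM ler_expR.
      have -> : t / (2 * a) * (a - 1) = 2^-1 * t * ((a - 1) / a) by field; rewrite gt_eqF.
      rewrite ler_piMr// ?mulr_ge0 ?ltW//.
      by rewrite ltr_pdivrMr// mul1r ltrBlDr ltrDl.
    apply: (@le_trans _ _ (expR (2^-1 * t) * expR (- 2^-1 * t))).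
      by rewrite ler_wpM2r ?expR_ge0.
    by rewrite -expRD mulNr subrr expR0.
rewrite ge0_integralZl//.
- rewrite integral_exponential_pdf ?invr_gt0// mule1 ltry//.
- by apply/measurable_EFinP; exact: measurable_exponential_pdf.
- by move=> t _; rewrite lee_fin exponential_pdf_ge0.
- by rewrite lee_fin mulr_ge0.
Qed.

Lemma egammaM (a b : R) : (egamma a * egamma b = egamma (a + b) * ebeta a b)%E.
Proof.
have mE c : measurable_fun setT (fun t : R => (pospow c t * expR (- t))%:E).
  by apply/measurable_EFinP; exact: measurable_egamma_integrand.
have E0 (c t : R) : (0 <= (pospow c t * expR (- t))%:E)%E.
  by rewrite lee_fin egamma_integrand_ge0.
have G0 c : (0 <= egamma c)%E by apply: integral_ge0 => t _; exact: E0.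
have mexp : measurable_fun setT (fun p : R * R => (expR (- p.1))%:E).
  apply/measurable_EFinP; apply: measurableT_comp; first exact: measurable_expR.
  exact: measurableT_comp.
have exp0 (p : R * R) : (0 <= (expR (- p.1))%:E)%E by rewrite lee_fin expR_ge0.
have B0 : (0 <= ebeta a b)%E.
  by apply: integral_ge0 => t _; rewrite lee_fin mulr_ge0 ?pospow_ge0.
have mB : measurable_fun setT (fun p : R => (pospow a p * pospow b (1 - p))%:E).
  apply/measurable_EFinP/measurable_funM; first exact: measurable_pospow.
  by apply: (measurableT_comp (@measurable_pospow R b)); exact: measurable_funB.
transitivity (\int[mu]_x \int[mu]_y
    ((pospow a x * pospow b y)%:E * (expR (- (x + y)))%:E))%E.
  transitivity (\int[mu]_x ((pospow a x * expR (- x))%:E * egamma b))%E.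
    by rewrite ge0_integralZr//; exact: mE.
  apply: eq_integral => x _; rewrite -ge0_integralZl//; last exact: mE.
  apply: eq_integral => y _; rewrite -!EFinM; congr EFin.
  by rewrite opprD expRD; ring.
rewrite (ge0_integral_beta_gamma a b mexp exp0) -ge0_integralZr//; last exact: mE.
apply: eq_integral => s _; rewrite -ge0_integralZl//; last first.
  by move=> p _; rewrite lee_fin mulr_ge0 ?pospow_ge0.
apply: eq_integral => p _; rewrite -!EFinM; congr EFin => /=; ring.
Qed.

(** Finiteness is read backwards in [egammaM]: the right side is finite and both left factors are
    positive, so neither is infinite. This spares an estimate of the singular Gamma integrand at
    parameter 1/2. *)
Lemma Betaf_ebeta (a b : R) : 1 <= a + b -> (0 < ebeta a b < +oo)%E ->
  (Betaf a b)%:E = ebeta a b.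
Proof.
move=> ab /andP[B0 Boo].
have := egammaM a b.
have := egamma_lty ab; have := egamma_gt0 (a + b).
have := egamma_gt0 a; have := egamma_gt0 b.
rewrite /Betaf !Gammaf_egamma.
case: (ebeta a b) B0 Boo => [B||]//; rewrite lte_fin => B0 _.
case: (egamma (a + b)) => [G||]//.
case: (egamma a) => [x||]//; case: (egamma b) => [y||]//=; rewrite !lte_fin => y0 x0 G0 _.
- by rewrite -!EFinM => -[->]; rewrite mulrAC divff ?mul1r// gt_eqF.
- by rewrite gt0_muley// lte_fin.
- by rewrite gt0_mulye// lte_fin.
Qed.

End gamma_beta.

(** * The law of the cosine *)

Section cosine.
Variable R : realType.
Local Notation mu := (@lebesgue_measure R).

(** Meant for the squared norm; excluding 0 removes the origin, which has no direction. *)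
Definition unit_itv_ind (r : R) : R := if (0 < r <= 1) then 1 else 0.

Lemma unit_itv_ind_ge0 r : 0 <= unit_itv_ind r.
Proof. by rewrite /unit_itv_ind; case: ifP. Qed.

Lemma measurable_unit_itv_ind : measurable_fun setT unit_itv_ind.
Proof.
apply: measurable_fun_ifT => //; apply: measurable_and.
- exact: measurable_fun_ltr.
- exact: measurable_fun_ler.
Qed.

(* Here s = u^2 + w and p = u^2 / s is the square of the cosine. *)
Lemma ge0_integral_cosine (b : R) (g : R -> R) :
  measurable_fun setT g -> (forall t, 0 <= g t) ->
  (\int[mu]_u \int[mu]_w ((pospow b w)%:E *
     (unit_itv_ind (u ^+ 2 + w) * g (u / Num.sqrt (u ^+ 2 + w)))%:E) =
   (\int[mu]_s (pospow (2^-1 + b) s * unit_itv_ind s)%:E) *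
   \int[mu]_t (g t * pospow b (1 - t ^+ 2))%:E)%E.
Proof.
move=> mg g0.
have mq := @measurable_pospow R.
have msqrt : measurable_fun setT (@Num.sqrt R).
  by apply: continuous_measurable_fun; exact: sqrt_continuous.
pose G (p : R * R) := ((pospow b p.2)%:E *
  (unit_itv_ind (p.1 ^+ 2 + p.2) * g (p.1 / Num.sqrt (p.1 ^+ 2 + p.2)))%:E)%E.
have mr : measurable_fun setT (fun p : R * R => p.1 ^+ 2 + p.2).
  by apply: measurable_funD => //; apply: measurable_funX.
have mG : measurable_fun setT G.
  apply: emeasurable_funM.
    by apply/measurable_EFinP; apply: (measurableT_comp (mq b)).
  apply/measurable_EFinP/measurable_funM.
    by apply: (measurableT_comp measurable_unit_itv_ind).
  apply: (measurableT_comp mg); apply: measurable_funM => //.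
  by apply: (measurableT_comp (@measurable_invr R)); apply: (measurableT_comp msqrt).
have G0 p : (0 <= G p)%E.
  by rewrite mule_ge0 ?lee_fin ?pospow_ge0// mulr_ge0 ?unit_itv_ind_ge0.
(* Collects u and -u, whose cosines are sqrt p and - sqrt p. *)
pose h (p : R * R) := (unit_itv_ind p.1 *
  (g (Num.sqrt p.2) + g (- Num.sqrt p.2)))%:E.
have mh : measurable_fun setT h.
  apply/measurable_EFinP/measurable_funM.
    by apply: (measurableT_comp measurable_unit_itv_ind).
  apply: measurable_funD; apply: (measurableT_comp mg).
    by apply: (measurableT_comp msqrt).
  by apply: measurableT_comp => //; apply: (measurableT_comp msqrt).
have h0 p : (0 <= h p)%E.
  by rewrite lee_fin mulr_ge0 ?unit_itv_ind_ge0// addr_ge0.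
pose H (p : R * R) := ((pospow 2^-1 p.1 * pospow b p.2)%:E *
  h (p.1 + p.2, p.1 / (p.1 + p.2))%R)%E.
have mH : measurable_fun setT H.
  apply: emeasurable_funM.
    apply/measurable_EFinP/measurable_funM; first by apply: (measurableT_comp (mq _)).
    by apply: (measurableT_comp (mq _)).
  apply: measurable_comp2 => //; first exact: measurable_funD.
  apply: measurable_funM => //; apply: (measurableT_comp (@measurable_invr R)).
  exact: measurable_funD.
have H0 p : (0 <= H p)%E.
  by rewrite mule_ge0// lee_fin mulr_ge0 ?pospow_ge0.
pose k t := (g t * pospow b (1 - t ^+ 2))%:E.
have mk : measurable_fun setT k.
  apply/measurable_EFinP/measurable_funM => //; apply: (measurableT_comp (mq b)).
  by apply: measurable_funB.
have k0 t : (0 <= k t)%E by rewrite lee_fin mulr_ge0 ?pospow_ge0.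
(* The swap makes u, the variable to be squared, the inner one. *)
transitivity (\int[mu]_w \int[mu]_u G (u, w))%E; first exact: ge0_integral_swap.
transitivity (\int[mu]_w (2^-1%:E * \int[mu]_q H (q, w)))%E.
  apply: eq_integral => w _.
  have mGw : measurable_fun setT (fun u : R => G (u, w)).
    by apply: measurable_comp2.
  rewrite (ge0_integral_sqrt_symmetrize mGw)//; congr (_ * _)%E.
  apply: eq_integral => q _; rewrite /G /H /h /=.
  have [q0|q0] := leP q 0; first by rewrite (pospow_eq0 _ q0) mul0e mul0r mul0e.
  have [w0|w0] := leP w 0.
    by rewrite (pospow_eq0 b w0) !mul0e adde0 mule0 mulr0 mul0e.
  rewrite sqrrN sqr_sqrtr ?ltW// mulNr.
  have -> : Num.sqrt q / Num.sqrt (q + w) = Num.sqrt (q / (q + w)).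
    by rewrite sqrtrM ?ltW// sqrtrV// addr_ge0// ltW.
  by rewrite -!EFinM; congr EFin; ring.
rewrite ge0_integralZl//; last 2 first.
- exact: measurable_integral2.
- by move=> w _; exact: integral_ge0.
have -> : (\int[mu]_w \int[mu]_q H (q, w) = \int[mu]_q \int[mu]_w H (q, w))%E.
  exact/esym/(ge0_integral_swap mH).
have -> : (\int[mu]_q \int[mu]_w H (q, w) = \int[mu]_s \int[mu]_p
    ((pospow (2^-1 + b) s * (pospow 2^-1 p * pospow b (1 - p)))%:E * h (s, p)))%E.
  exact: (ge0_integral_beta_gamma 2^-1 b mh h0).
(* The integral over p = t^2; undoing the symmetrization at the end turns half of it into the
   integral over t. *)
pose L := (\int[mu]_p ((pospow 2^-1 p)%:E * (k (Num.sqrt p) + k (- Num.sqrt p)%R)))%E.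
have mL : measurable_fun setT (fun p : R => (pospow 2^-1 p)%:E * (k (Num.sqrt p) + k (- Num.sqrt p)%R))%E.
  apply: emeasurable_funM; first exact: measurable_EFin_pospow.
  apply: emeasurable_funD; apply: (measurableT_comp mk) => //.
  by apply: measurableT_comp.
have pL0 (p : R) : (0 <= (pospow 2^-1 p)%:E * (k (Num.sqrt p) + k (- Num.sqrt p)%R))%E.
  by apply: mule_ge0; [rewrite lee_fin pospow_ge0|exact: adde_ge0].
have L0 : (0 <= L)%E by exact: integral_ge0.
transitivity (2^-1%:E * \int[mu]_s ((pospow (2^-1 + b) s * unit_itv_ind s)%:E * L))%E.
  congr (_ * _)%E; apply: eq_integral => s _.
  rewrite -ge0_integralZl//; last by rewrite lee_fin mulr_ge0 ?pospow_ge0 ?unit_itv_ind_ge0.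
  apply: eq_integral => p _; rewrite /h /k /=.
  have [p0|p0] := leP p 0; first by rewrite (pospow_eq0 _ p0) mul0r mulr0 !mul0e mule0.
  by rewrite sqrrN sqr_sqrtr ?ltW// -!EFinM; congr EFin; ring.
rewrite ge0_integralZr//; last 2 first.
- apply/measurable_EFinP/measurable_funM; first exact: mq.
  exact: measurable_unit_itv_ind.
- by move=> s _; rewrite lee_fin mulr_ge0 ?pospow_ge0 ?unit_itv_ind_ge0.
by rewrite muleCA; congr (_ * _)%E; rewrite -(ge0_integral_sqrt_symmetrize mk).
Qed.

(** Under t = 2 z - 1 one has 1 + t = 2 z and 1 - t^2 = 4 z (1 - z); the constant collects the
    Jacobian 2 and the powers of 2 and 4. *)
Lemma ge0_integral_cosine_beta (b kappa : R) (ind : R -> R) :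
  measurable_fun setT ind -> (forall t, 0 <= ind t) ->
  (\int[mu]_t (ind t * (1 + t) `^ kappa * pospow b (1 - t ^+ 2))%:E =
   (2 * 2 `^ kappa * 4 `^ (b - 1))%:E *
   \int[mu]_z (ind (2 * z - 1) * (pospow (b + kappa) z * pospow b (1 - z)))%:E)%E.
Proof.
move=> mi i0.
have mq := @measurable_pospow R.
have m1 : measurable_fun setT (fun t => (ind t * (1 + t) `^ kappa * pospow b (1 - t ^+ 2))%:E).
  apply/measurable_EFinP/measurable_funM.
    apply: measurable_funM => //; apply: (@measurableT_comp _ _ _ _ _ _ (fun x : R => x `^ kappa)) => //.
    exact: measurable_funD.
  by apply: (measurableT_comp (mq b)); exact: measurable_funB.
rewrite (@ge0_integral_affine _ 2 (-1) _ _ m1)//; last first.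
  by move=> t; rewrite lee_fin !mulr_ge0 ?powR_ge0 ?pospow_ge0.
rewrite -!mulrA EFinM -muleA; congr (_ * _)%E.
rewrite -ge0_integralZl; [|by []| | |]; last 3 first.
- apply/measurable_EFinP/measurable_funM.
    by apply: (measurableT_comp mi); exact: measurable_affine.
  apply: measurable_funM; [exact: mq|apply: (measurableT_comp (mq b))].
  exact: measurable_funB.
- by move=> z _; rewrite lee_fin !mulr_ge0 ?pospow_ge0.
- by rewrite lee_fin mulr_ge0 ?powR_ge0.
apply: eq_integral => z _; rewrite -EFinM; congr EFin.
rewrite (_ : 1 - (2 * z - 1) ^+ 2 = 4 * (z * (1 - z))); last by ring.
rewrite (_ : 1 + (2 * z - 1) = 2 * z); last by ring.
rewrite pospowM//.
(* Splitting the power of z (1 - z) uses z > 0; for z <= 0 this product is at most 0 and both sides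
   vanish. *)
have [z0|z0] := leP z 0.
  rewrite (pospow_eq0 _ z0) (@pospow_eq0 _ b (z * (1 - z))) ?mulr0 ?mul0r ?mulr0//.
  by rewrite mulr_le0_ge0// subr_ge0 (le_trans z0).
rewrite pospowM// powRM ?ltW//.
have -> : pospow (b + kappa) z = z `^ (b - 1) * z `^ kappa.
  by rewrite /pospow z0 -powRD ?(gt_eqF z0) ?implybT//; congr (_ `^ _); ring.
ring.
Qed.

End cosine.

(** * Surface measure *)

Section set_function_integral.
Context (d : measure_display) (T : measurableType d) (R : realType).
Variables m1 m2 : set T -> \bar R.
Hypothesis m12 : forall A, measurable A -> m1 A = m2 A.

Import HBNNSimple.

(** The integral is built from simple functions, which evaluate the set function on measurable level
    sets only. This is what lets the bare set function [surface] be replaced by a measure. *)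
Lemma eq_setfun_integral (D : set T) (f : T -> \bar R) :
  (\int[m1]_(x in D) f x = \int[m2]_(x in D) f x)%E.
Proof.
have E (h : {nnsfun T >-> R}) : sintegral m1 h = sintegral m2 h.
  by apply: eq_fsbigr => r _; rewrite m12.
rewrite /integral; congr (ereal_sup _ - ereal_sup _)%E;
  by apply/seteqP; split => _ [h hf <-]; exists h; rewrite ?E.
Qed.

End set_function_integral.

Section surface.
Variables (R : realType) (d : nat).
Local Notation mu := (@lebesgue_measure R).

Definition normalize (y : d.-tuple R) := scalev (Num.sqrt (dotv y y))^-1 y.

Lemma dotv_scaler (m y : d.-tuple R) r : dotv m (scalev r y) = r * dotv m y.
Proof. by rewrite /dotv mulr_sumr; apply: eq_bigr => i _; rewrite tnth_mktuple mulrCA. Qed.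

Lemma dotvC (x y : d.-tuple R) : dotv x y = dotv y x.
Proof. by apply: eq_bigr => i _; rewrite mulrC. Qed.

Lemma dotv_scale2 (y : d.-tuple R) r : dotv (scalev r y) (scalev r y) = r ^+ 2 * dotv y y.
Proof. by rewrite dotv_scaler dotvC dotv_scaler mulrA expr2. Qed.

Lemma scalev_scalev r s (y : d.-tuple R) : scalev r (scalev s y) = scalev (r * s) y.
Proof. by apply: eq_from_tnth => i; rewrite !tnth_mktuple mulrA. Qed.

Lemma scalev1 (y : d.-tuple R) : scalev 1 y = y.
Proof. by apply: eq_from_tnth => i; rewrite !tnth_mktuple mul1r. Qed.

Lemma measurable_sqrt_dotv : measurable_fun setT (fun y : d.-tuple R => Num.sqrt (dotv y y)).
Proof.
apply: (measurableT_comp (f := @Num.sqrt R)).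
  by apply: continuous_measurable_fun; exact: sqrt_continuous.
exact: measurable_dotv.
Qed.

Lemma measurable_normalize : measurable_fun setT normalize.
Proof.
apply/measurable_fun_tnthP => i.
rewrite (_ : _ \o _ = fun y => (Num.sqrt (dotv y y))^-1 * tnth y i); last first.
  by apply/funext => y /=; rewrite tnth_mktuple.
apply: measurable_funM; last exact: measurable_tnth.
by apply: (measurableT_comp (@measurable_invr R)); exact: measurable_sqrt_dotv.
Qed.

Lemma measurable_sphere : measurable (@sphere R d).
Proof.
have -> : @sphere R d = setT `&` (fun y => dotv y y) @^-1` [set 1].
  by rewrite setTI; apply/seteqP; split.
by apply: measurable_dotv.
Qed.

Lemma normalize_sphere y : 0 < dotv y y -> @sphere R d (normalize y).
Proof.
move=> y0; rewrite /sphere /= dotv_scale2 exprVn sqr_sqrtr ?ltW//.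
by rewrite mulVf// gt_eqF.
Qed.

(** With the existential replaced by a preimage, [lam (cone A)] becomes the image under [normalize]
    of Lebesgue measure on the punctured ball, for measurable [A]. *)
Lemma cone_normalize (A : set (d.-tuple R)) :
  cone A = [set y | 0 < dotv y y <= 1] `&` normalize @^-1` A.
Proof.
apply/seteqP; split => [y [r [x [/andP[r0 r1] [Ax Sx] ->]]]|y [/= /andP[y0 y1] Ay]].
- have E : dotv (scalev r x) (scalev r x) = r ^+ 2 by rewrite dotv_scale2 Sx mulr1.
  split=> /=; first by rewrite E exprn_gt0//= expr_le1// ltW.
  by rewrite /normalize E sqrtr_sqr gtr0_norm// scalev_scalev mulVf ?gt_eqF// scalev1.
- exists (Num.sqrt (dotv y y)), (normalize y).
  have s0 : 0 < Num.sqrt (dotv y y) by rewrite sqrtr_gt0.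
  split.
  + by rewrite s0 -sqrtr1 ler_sqrt.
  + by split => //; exact: normalize_sphere.
  + by rewrite scalev_scalev divff ?gt_eqF// scalev1.
Qed.

Lemma ge0_integral_surface (lam : {measure set (d.-tuple R) -> \bar R})
    (D : set (d.-tuple R)) (g : d.-tuple R -> \bar R) :
  measurable D -> measurable_fun setT g -> (forall x, (0 <= g x)%E) ->
  (\int[surface lam]_(x in D) g x = d%:R%:E *
    \int[lam]_y ((unit_itv_ind (dotv y y))%:E * (g \_ D) (normalize y)))%E.
Proof.
move=> mD mg g0.
have mw : measurable_fun setT (fun y : d.-tuple R => unit_itv_ind (dotv y y)).
  by apply: (measurableT_comp (@measurable_unit_itv_ind R)); exact: measurable_dotv.
have [nu1 [nu1A nu1g]] := density_measure lam mw (fun y => unit_itv_ind_ge0 _).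
have [nu nuE] := pushforward_measure_ex nu1 measurable_normalize.
have mU : measurable [set y : d.-tuple R | 0 < dotv y y <= 1].
  have -> : [set y : d.-tuple R | 0 < dotv y y <= 1] =
      setT `&` (fun y => dotv y y) @^-1` `]0, 1].
    by rewrite setTI; apply/seteqP; split => y /=; rewrite in_itv.
  by apply: measurable_dotv.
have surfE A : measurable A -> surface lam A = mscale (@NngNum _ d%:R (ler0n _ _)) nu A.
  move=> mA; rewrite /mscale /= /surface; congr (_ * _)%E.
  rewrite nuE /pushforward nu1A cone_normalize.
  have mNA : measurable (normalize @^-1` A).
    by rewrite -[X in measurable X]setTI; exact: measurable_normalize.
  rewrite -(integral_indic lam mNA mU); apply: eq_integral => y _.
  rewrite indicE /unit_itv_ind; case: ifPn => h; first by rewrite mem_set.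
  by rewrite memNset//; exact/negP.
rewrite (eq_setfun_integral surfE) integral_mkcond.
have mgD : measurable_fun setT (g \_ D).
  by apply/(measurable_restrictT _ mD); exact: measurable_funS mg.
have gD0 x : (0 <= (g \_ D) x)%E by apply: erestrict_ge0.
rewrite ge0_integral_mscale//=; congr (_ * _)%E.
transitivity (\int[nu1]_y (g \_ D) (normalize y))%E.
  apply: ge0_integral_comp_measure_preserving => //; first exact: measurable_normalize.
  by move=> A mA; rewrite nuE.
rewrite nu1g//; apply: (measurableT_comp mgD); exact: measurable_normalize.
Qed.

End surface.

(** * The density of T *)

Section law.
Variable R : realType.
Local Notation mu := (@lebesgue_measure R).

Definition beta_mass (a b : R) (B : set R) : \bar R :=
  (\int[mu]_z (\1_B (2 * z - 1) * (pospow a z * pospow b (1 - z)))%:E)%E.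

Lemma measurable_beta_mass_integrand (a b : R) (B : set R) : measurable B ->
  measurable_fun setT (fun z : R => \1_B (2 * z - 1) * (pospow a z * pospow b (1 - z)) : R).
Proof.
move=> mB; have mq := @measurable_pospow R.
apply: measurable_funM.
  by apply: (@measurableT_comp _ _ _ _ _ _ (\1_B : R -> R)) => //; exact: measurable_affine.
apply: measurable_funM; first exact: mq.
by apply: (measurableT_comp (mq b)); exact: measurable_funB.
Qed.

Lemma beta_mass_integrand_ge0 (a b : R) (B : set R) z :
  0 <= (\1_B (2 * z - 1) : R) * (pospow a z * pospow b (1 - z)).
Proof. by rewrite !mulr_ge0 ?pospow_ge0// indicE. Qed.

Lemma beta_mass_ge0 (a b : R) (B : set R) : (0 <= beta_mass a b B)%E.
Proof. by apply: integral_ge0 => z _; rewrite lee_fin beta_mass_integrand_ge0. Qed.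

Lemma beta_massT (a b : R) : beta_mass a b setT = ebeta a b.
Proof. by apply: eq_integral => z _; rewrite indicT mul1r. Qed.

Lemma le_beta_massT (a b : R) (B : set R) : measurable B ->
  (beta_mass a b B <= beta_mass a b setT)%E.
Proof.
move=> mB; apply: ge0_le_integral => //.
- by move=> z _; rewrite lee_fin beta_mass_integrand_ge0.
- by apply/measurable_EFinP; exact: measurable_beta_mass_integrand.
- by apply/measurable_EFinP; exact: measurable_beta_mass_integrand.
- move=> z _; rewrite lee_fin indicT ler_wpM2r ?mulr_ge0 ?pospow_ge0//.
  by rewrite indicE lern1 leq_b1.
Qed.

Lemma integral_beta_dens (a b : R) (B : set R) : measurable B -> 0 < Betaf a b ->
  (\int[mu]_(z in `[0%R, 1%R] `&` (fun z : R => (2 * z - 1)%R) @^-1` B)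
     (beta_dens a b z)%:E = beta_mass a b B * (Betaf a b)^-1%:E)%E.
Proof.
move=> mB b0; have mz : measurable_fun setT (fun z : R => 2 * z - 1) by exact: measurable_affine.
have mD : measurable (`[0%R, 1%R] `&` (fun z : R => (2 * z - 1)%R) @^-1` B).
  apply: measurableI => //.
  by rewrite -[X in measurable X]setTI; exact: mz.
have mdens : measurable_fun setT (fun z : R => (beta_dens a b z)%:E).
  apply/measurable_EFinP; apply: measurable_funM => //; apply: measurable_funM.
    exact: measurable_powR.
  apply: (@measurableT_comp _ _ _ _ _ _ (fun x : R => x `^ (b - 1))) => //.
  exact: measurable_funB.
rewrite integral_mkcond /beta_mass -ge0_integralZr//; last 3 first.
- by apply/measurable_EFinP; exact: measurable_beta_mass_integrand.
- by move=> z _; rewrite lee_fin beta_mass_integrand_ge0.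
- by rewrite lee_fin invr_ge0 ltW.
apply: ge0_ae_eq_integral => //.
- by apply/(measurable_restrictT _ mD); exact: measurable_funS mdens.
- apply: emeasurable_funM => //; apply/measurable_EFinP.
  exact: measurable_beta_mass_integrand.
- move=> z _; apply: erestrict_ge0 => x _.
  by rewrite lee_fin !mulr_ge0 ?powR_ge0// invr_ge0 ltW.
- by move=> z _; rewrite mule_ge0// lee_fin ?beta_mass_integrand_ge0// invr_ge0 ltW.
(* The integrands can differ at the endpoints: [powR] at 0 is 1 for exponent 0, whereas [pospow] is
   0 there. *)
exists [set 0; 1]; split => //.
- by apply: measurableU; exact: measurable_set1.
- by rewrite measureU0 //; exact: lebesgue_measure_set1.
move=> z /= h; have [->|z0] := eqVneq z 0; first by left.
have [->|z1] := eqVneq z 1; first by right.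
exfalso; apply: h => _; rewrite patchE.
case: ifPn => [|]; rewrite (inE, notin_setE) /= in_itv /=.
  move=> [/andP[h0 h1] Bz].
  rewrite indicE mem_set// mul1r -EFinM /beta_dens /pospow.
  by rewrite subr_gt0 !lt_def z0 h0 h1 eq_sym z1.
move=> nh; rewrite /pospow subr_gt0.
have [z0'|] := ltP 0 z; last by rewrite mul0r mulr0 mul0e.
have [z1'|] := ltP z 1; last by rewrite !mulr0 mul0e.
rewrite indicE memNset ?mul0r ?mul0e// => Bz; apply: nh; split => //.
by rewrite !ltW.
Qed.

(** [C] is chosen before [B], so it cancels in the quotient that gives the law of [X], once it is
    known to be positive and finite. *)
Lemma integral_surface_dotv_preimage n (kappa : R)
    (lam : {measure set (n.+2.-tuple R) -> \bar R}) (m : n.+2.-tuple R) :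
  is_lebesgue lam -> sphere m ->
  exists2 C : \bar R, (0 <= C)%E & forall B : set R, measurable B ->
    (\int[surface lam]_(x in (fun x => dotv m x) @^-1` B `&` @sphere R n.+2)
       (ps_dens m kappa x)%:E =
     C * beta_mass (n.+1%:R / 2 + kappa) (n.+1%:R / 2) B)%E.
Proof.
move=> hlam hm; have [c c0 jl] := joint_law_ex R n.
set b := n.+1%:R / 2.
pose S := (\int[mu]_s (pospow (2^-1 + b) s * unit_itv_ind s)%:E)%E.
pose K := 2 * 2 `^ kappa * 4 `^ (b - 1) : R.
(* In order: the dimension factor of [surface], the factor of the joint law, the radial integral,
   and the constant of t = 2 z - 1. *)
exists (n.+2%:R%:E * (c * (S * K%:E)))%E.
  rewrite !mule_ge0 ?lee_fin ?mulr_ge0 ?powR_ge0//.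
  by apply: integral_ge0 => s _; rewrite lee_fin mulr_ge0 ?pospow_ge0 ?unit_itv_ind_ge0.
move=> B mB.
have mpw : measurable_fun setT (fun t : R => (1 + t) `^ kappa).
  apply: (@measurableT_comp _ _ _ _ _ _ (fun x : R => x `^ kappa)) => //.
  exact: measurable_funD.
have mdot : measurable_fun setT (fun x : n.+2.-tuple R => dotv m x).
  exact: measurable_dotv.
have mD : measurable ((fun x => dotv m x) @^-1` B `&` @sphere R n.+2).
  apply: measurableI; last exact: measurable_sphere.
  by rewrite -[X in measurable X]setTI; exact: mdot.
have mdens : measurable_fun setT (fun x : n.+2.-tuple R => (ps_dens m kappa x)%:E).
  by apply/measurable_EFinP; exact: (measurableT_comp mpw mdot).
rewrite ge0_integral_surface//; last by move=> x; rewrite lee_fin powR_ge0.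
pose g (t : R) := \1_B t * (1 + t) `^ kappa : R.
have mg : measurable_fun setT g by apply: measurable_funM.
have g0 t : 0 <= g t by rewrite mulr_ge0 ?powR_ge0// indicE.
pose f (p : R * R) := (unit_itv_ind p.2 * g (p.1 / Num.sqrt p.2))%:E.
have mf : measurable_fun setT f.
  apply/measurable_EFinP/measurable_funM.
    by apply: (measurableT_comp (@measurable_unit_itv_ind R)).
  apply: (measurableT_comp mg); apply: measurable_funM => //.
  apply: (measurableT_comp (@measurable_invr R)).
  apply: (measurableT_comp (f := @Num.sqrt R)) => //.
  by apply: continuous_measurable_fun; exact: sqrt_continuous.
have f0 p : (0 <= f p)%E by rewrite lee_fin mulr_ge0 ?unit_itv_ind_ge0.
rewrite -!muleA; congr (_ * _)%E.
(* On the punctured ball the sphere condition holds by itself, and the integrand depends on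
   [normalize y] only through its cosine with [m]. *)
transitivity (\int[lam]_y f (dotv m y, dotv y y))%E.
  apply: eq_integral => y _; rewrite /f /unit_itv_ind /=.
  case: ifPn => [/andP[y0 _]|_]; last by rewrite mul0r mul0e.
  rewrite mul1e mul1r patchE /g.
  have E : dotv m (normalize y) = dotv m y / Num.sqrt (dotv y y).
    by rewrite dotv_scaler mulrC.
  rewrite -E indicE; have [By|By] := boolP (dotv m (normalize y) \in B).
    rewrite mem_set ?mul1r//; split; first by move: By; rewrite inE.
    exact: normalize_sphere.
  rewrite memNset ?mul0r// => -[By' _].
  by move: By; rewrite notin_setE; apply.
rewrite (jl _ _ _ hlam hm mf f0); congr (_ * _)%E.
apply: (eq_trans (ge0_integral_cosine b mg g0)).
congr (_ * _)%E; rewrite /g.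
by apply: ge0_integral_cosine_beta => // t; rewrite indicE.
Qed.

End law.

Unset Implicit Arguments.

Theorem theorem12 (R : realType) (d : nat) (hd : (2 <= d)%N)
  (mu : d.-tuple R) (hmu : @sphere R d mu) (kappa : R) (hkappa : 0 <= kappa)
  (lam : {measure set (d.-tuple R) -> \bar R}) (hlam : is_lebesgue lam)
  (dO : measure_display) (Omega : measurableType dO) (P : probability Omega R)
  (X : Omega -> d.-tuple R) (mX : measurable_fun setT X)
  (hX : forall A : set (d.-tuple R), measurable A ->
      P (X @^-1` A) =
      ((\int[surface lam]_(x in A `&` @sphere R d) (ps_dens mu kappa x)%:E) /
       (\int[surface lam]_(x in @sphere R d) (ps_dens mu kappa x)%:E))%E) :
  let alpha : R := (d%:R - 1) / 2 + kappa in
  let beta : R := (d%:R - 1) / 2 in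
  forall B : set R, measurable B ->
    P ((fun w => dotv mu (X w)) @^-1` B) =
    (\int[@lebesgue_measure R]_(z in `[0%R, 1%R] `&` (fun z : R => (2 * z - 1)%R) @^-1` B)
        (beta_dens alpha beta z)%:E)%E.
Proof.
move=> alpha beta B mB.
case: d hd mu hmu lam hlam X mX hX @alpha @beta => [|[|n]]// _ mu hmu lam hlam X mX hX.
have -> : (n.+2%:R - 1) / 2 = n.+1%:R / 2 :> R.
  by rewrite -[n.+2]addn1 natrD addrK.
move=> alpha beta.
have [C C0 CE] := integral_surface_dotv_preimage kappa hlam hmu.
have mdot : measurable_fun setT (fun x : n.+2.-tuple R => dotv mu x).
  exact: measurable_dotv.
have PE A : measurable A -> P ((fun w => dotv mu (X w)) @^-1` A) =
    (C * beta_mass alpha beta A / (C * beta_mass alpha beta setT))%E.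
  move=> mA; rewrite -!CE// preimage_setT setTI.
  apply: (hX ((fun x => dotv mu x) @^-1` A)).
  by rewrite -[X in measurable X]setTI; exact: mdot.
have := PE setT measurableT; rewrite preimage_setT probability_setT.
have := le_beta_massT alpha beta mB; have := beta_mass_ge0 alpha beta B.
have := beta_mass_ge0 alpha beta setT.
have := PE B mB.
have ab : 1 <= alpha + beta.
  have -> : alpha + beta = n.+1%:R + kappa by rewrite /alpha /beta; field.
  by rewrite -[n.+1]add1n natrD -addrA lerDl addr_ge0.
have BI i : beta_mass alpha beta setT = i%:E -> 0 < i -> Betaf alpha beta = i.
  move=> iE i0; apply: EFin_inj; rewrite -iE beta_massT.
  by apply: Betaf_ebeta => //; rewrite -beta_massT iE lte_fin i0 ltry.
move=> -> I0 IB0 IBI one.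
have {one} [c' [i [CE' iE c'0 i0]]] : exists c' i, [/\ C = c'%:E,
    beta_mass alpha beta setT = i%:E, 0 < c' & 0 < i].
  (* With the conventions of the extended inverse, x / x = 1 fails for x zero or infinite, so total
     mass 1 makes this product finite and nonzero. *)
  have CI : (C * beta_mass alpha beta setT)%E \is a fin_num /\
      (C * beta_mass alpha beta setT != 0)%E.
    move: one; case: (inveP (C * beta_mass alpha beta setT)%E).
    - by rewrite mul0e => /eqP; rewrite eqe oner_eq0.
    - by rewrite mule0 => /eqP; rewrite eqe oner_eq0.
    - by rewrite mulNyNy => /eqP.
    - by move=> r r0 _; split => //; rewrite eqe.
  (* Both factors are nonnegative, and an infinite one would make the product 0 or infinite. *)
  case: CI; move: C0 I0; clear.
  case: C => [c'||]//; case: (beta_mass alpha beta setT) => [i||]//; rewrite ?lee_fin.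
  - move=> c0 i0 _ ; rewrite -EFinM eqe mulf_eq0 negb_or => /andP[c1 i1].
    by exists c', i; rewrite !lt_def c1 i1 c0 i0.
  - rewrite le_eqVlt => /orP[/eqP <-|c0 _]; first by rewrite mul0e eqxx.
    by rewrite gt0_muley// lte_fin.
  - move=> _; rewrite le_eqVlt => /orP[/eqP <-|i0]; first by rewrite mule0 eqxx.
    by rewrite gt0_mulye// lte_fin.
have Bi := BI i iE i0.
rewrite integral_beta_dens ?Bi// CE' iE.
(* The mass of [B] lies between 0 and the finite total mass, so it is finite. *)
move: IB0 IBI; rewrite iE; case: (beta_mass alpha beta B) => [j||]// _ _.
rewrite -!EFinM inver mulf_eq0 !gt_eqF//= -EFinM; congr EFin.
by field; rewrite !gt_eqF.
Qed.
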